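(* Let $\mathbb{S}^2$ be the unit sphere centered at the origin in $\mathbb{R}^3$, and let $\mathbb{S}^2 = S_1 \cup S_2 \cup S_3 \cup S_4$ be an orthogonal 4-coloring of $\mathbb{S}^2$. Then the coloring is octahedral if and only if each color class is locally octahedral, i.e. $(u\cdot v)(u\cdot w)(v\cdot w)\geq 0$ for all $u,v,w$ in the same color class $S_i$.
   Context: A $k$-coloring of $\mathbb{S}^2$ is a partition of $\mathbb{S}^2$ into $k$ non-empty parts $S_1,\dots,S_k$ (the color classes). It is orthogonal if $u\cdot v\neq 0$ for every pair $u,v$ belonging to the same color class ($u\cdot v$ the standard dot product). A regular octahedron is the convex hull of $\{\pm u_1,\pm u_2,\pm u_3\}$ where $u_1,u_2,u_3$ is an orthonormal basis of $\mathbb{R}^3$. For $S\subset\mathbb{S}^2$, let $\ell(S)$ be the set of lines through the origin and a point of $S$; $S$ is octahedral if all lines in $\ell(S)$ pass through the closure of two opposite faces of a regular octahedron (centered at the origin). A 4-coloring is octahedral if each color class is octahedral. A set $S$ is locally octahedral if every subset $S'\subset S$ with $|S'|\leq 3$ is octahedral; equivalently $(u\cdot v)(u\cdot w)(v\cdot w)\ge 0$ for all $u,v,w\in S$. *)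

(* Defs.v *)
From mathcomp Require Import all_boot all_order all_algebra.
From mathcomp Require Import boolp classical_sets functions cardinality reals.
From mathcomp Require Import convex.

Set Implicit Arguments.
Unset Strict Implicit.
Unset Printing Implicit Defensive.
Import Order.TTheory GRing.Theory Num.Theory.
Local Open Scope classical_set_scope.
Local Open Scope ring_scope.

Definition dot (R : realType) (u v : 'rV[R]_3) : R := \sum_i u 0 i * v 0 i.

Definition sphere2 (R : realType) : set 'rV[R]_3 := [set v | dot v v = 1].

Definition coloring (R : realType) (k : nat) (S : 'I_k -> set 'rV[R]_3) : Prop :=
  partition [set: 'I_k] S (@sphere2 R).

Definition orthogonal_coloring (R : realType) (k : nat)
    (S : 'I_k -> set 'rV[R]_3) : Prop :=
  coloring S /\
  forall (i : 'I_k) (u v : 'rV[R]_3), S i u -> S i v -> dot u v != 0.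

(* Three orthonormal vectors of R^3 automatically form a basis. *)
Definition orthonormal_basis (R : realType) (e : 'I_3 -> 'rV[R]_3) : Prop :=
  forall i j, dot (e i) (e j) = (i == j)%:R.

Definition convex_hull (R : realType) (A : set 'rV[R]_3) : set 'rV[R]_3 :=
  smallest (fun C : set 'rV[R]_3 => convex_set (C : set (convex_lmodType 'rV[R]_3))) A.

Definition octahedron (R : realType) (e : 'I_3 -> 'rV[R]_3) : set 'rV[R]_3 :=
  convex_hull (range e `|` [set - e i | i in [set: 'I_3]]).

Definition regular_octahedron (R : realType) (O : set 'rV[R]_3) : Prop :=
  exists2 e : 'I_3 -> 'rV[R]_3, orthonormal_basis e & O = octahedron e.

(* Faces are the two-dimensional ones (for an octahedron, its eight
   triangles): sets of maximizers over P of a nonzero linear functional that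
   contain three affinely independent points.  They include their edges and
   vertices, so they are the closures of the corresponding open faces. *)
Definition closed_face (R : realType) (P F : set 'rV[R]_3) : Prop :=
  (exists2 c : 'rV[R]_3, c != 0 &
     F = [set x | P x /\ forall y, P y -> dot c y <= dot c x]) /\
  (exists a b d : 'rV[R]_3,
     [/\ F a, F b, F d & row_free (col_mx (b - a) (d - a))]).

Definition opposite (R : realType) (F : set 'rV[R]_3) : set 'rV[R]_3 :=
  [set - x | x in F].

Definition line_through (R : realType) (u : 'rV[R]_3) : set 'rV[R]_3 :=
  [set t *: u | t in [set: R]].

Definition lines (R : realType) (S : set 'rV[R]_3) : set (set 'rV[R]_3) :=
  [set line_through u | u in S].

Definition octahedral (R : realType) (S : set 'rV[R]_3) : Prop :=
  exists O F : set 'rV[R]_3,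
    [/\ regular_octahedron O, closed_face O F &
      forall L, lines S L ->
        L `&` F !=set0 /\ L `&` opposite F !=set0].

Definition octahedral_coloring (R : realType) (k : nat)
    (S : 'I_k -> set 'rV[R]_3) : Prop :=
  forall i, octahedral (S i).

Definition locally_octahedral (R : realType) (S : set 'rV[R]_3) : Prop :=
  forall S' : set 'rV[R]_3, S' `<=` S -> (S' #<= `I_3)%card -> octahedral S'.

(* Main.v *)
Require Import Defs.
From mathcomp Require Import all_boot all_order all_algebra.
From mathcomp Require Import boolp classical_sets functions cardinality reals.
From mathcomp Require Import interval_inference topology normedtype derive convex.
From mathcomp Require Import ring lra.
Import Order.TTheory GRing.Theory Num.Theory.
Import numFieldNormedType.Exports.
Local Open Scope classical_set_scope.
Local Open Scope ring_scope.
Set Implicit Arguments.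
Unset Strict Implicit.
Unset Printing Implicit Defensive.

(* Choosing signs in a locally octahedral color class gives vectors with pairwise
   nonnegative products, and a maximal such set M_i, given by Zorn's lemma, is a
   self-dual cone.  If M_i and M_j had a common interior direction x, then only
   the two other colors would occur near the great circle orthogonal to x, which
   is impossible.  Hence any two of the cones +-M_1, ..., +-M_4 can be separated
   by a plane; by self-duality the normal of a plane separating M_i from M_j is
   a point of M_i and of - M_j, and similarly M_i meets M_j.

   For p in both M_i and M_j and n in both M_i and - M_j, p and n are orthogonal
   and the plane they span is covered by the four cones +-M_i, +-M_j, so the
   other two cones lie on one side of it: the normal of that plane is, up to
   sign, in both of them.  Applying this to the complementary pair of cones
   yields a vector q lying, up to sign, in all four cones.  The same remark for
   all pairs of cones, now with p = q, puts so many vectors of the plane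
   orthogonal to q into the cones that, by comparing signs, each cone contains
   two orthogonal ones.  A self-dual cone containing an orthonormal basis is an
   octant. *)

(** * Self-dual cones that do not overlap *)

Section Vectors.
Context {R : realType}.
Implicit Types (u v w x y : 'rV[R]_3) (c : R).

Lemma dotE u v :
  dot u v = u 0 0 * v 0 0 + u 0 1 * v 0 1 + u 0 2%:R * v 0 2%:R.
Proof.
rewrite /dot !big_ord_recl big_ord0 addr0 addrA.
rewrite (_ : lift ord0 (lift ord0 ord0) = 2%:R); last exact/val_inj.
by rewrite (_ : lift ord0 ord0 = 1); last exact/val_inj.
Qed.

Lemma dotC u v : dot u v = dot v u.
Proof. by rewrite !dotE; ring. Qed.

Lemma dotDl u v w : dot (u + v) w = dot u w + dot v w.
Proof. by rewrite !dotE !mxE; ring. Qed.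

Lemma dotZl c u v : dot (c *: u) v = c * dot u v.
Proof. by rewrite !dotE !mxE; ring. Qed.

Lemma dotNl u v : dot (- u) v = - dot u v.
Proof. by rewrite !dotE !mxE; ring. Qed.

Lemma dotDr u v w : dot u (v + w) = dot u v + dot u w.
Proof. by rewrite dotC dotDl !(dotC u). Qed.

Lemma dotZr c u v : dot u (c *: v) = c * dot u v.
Proof. by rewrite dotC dotZl dotC. Qed.

Lemma dotNr u v : dot u (- v) = - dot u v.
Proof. by rewrite dotC dotNl dotC. Qed.

Lemma dot0l u : dot 0 u = 0.
Proof. by rewrite -(scale0r u) dotZl mul0r. Qed.

Definition dotL := (dotDl, dotDr, dotNl, dotNr, dotZl, dotZr).

Lemma dot_ge0 u : 0 <= dot u u.
Proof. by rewrite dotE -!expr2 !addr_ge0 ?sqr_ge0. Qed.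

Lemma vec3P u v :
  u 0 0 = v 0 0 -> u 0 1 = v 0 1 -> u 0 2%:R = v 0 2%:R -> u = v.
Proof.
move=> e0 e1 e2; apply/rowP => -[[|[|[|//]]] i3].
- by rewrite (_ : Ordinal i3 = 0) //; apply/val_inj.
- by rewrite (_ : Ordinal i3 = 1) //; apply/val_inj.
- by rewrite (_ : Ordinal i3 = 2%:R) //; apply/val_inj.
Qed.

Lemma dot_eq0 u : (dot u u == 0) = (u == 0).
Proof.
apply/eqP/eqP => [|->]; last by rewrite dot0l.
rewrite dotE => /eqP; rewrite -!expr2 !paddr_eq0 ?addr_ge0 ?sqr_ge0 //.
rewrite !sqrf_eq0 => /andP[/andP[/eqP u0 /eqP u1] /eqP u2].
by apply: vec3P; rewrite mxE.
Qed.

Lemma dot_gt0 u : (0 < dot u u) = (u != 0).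
Proof. by rewrite lt0r dot_ge0 andbT dot_eq0. Qed.

Lemma dot_unit_neq0 u : dot u u = 1 -> u != 0.
Proof. by move=> u1; rewrite -dot_eq0 u1 oner_eq0. Qed.

Definition vec (a b c : R) : 'rV[R]_3 :=
  \row_i (if i == 0 then a else if i == 1 then b else c).

Lemma vecE a b c : ((vec a b c 0 0 = a) * (vec a b c 0 1 = b)
  * (vec a b c 0 2%:R = c))%type.
Proof. by rewrite !mxE. Qed.

Definition cross u v : 'rV[R]_3 :=
  vec (u 0 1 * v 0 2%:R - u 0 2%:R * v 0 1)
      (u 0 2%:R * v 0 0 - u 0 0 * v 0 2%:R)
      (u 0 0 * v 0 1 - u 0 1 * v 0 0).

Lemma dot_crossl u v : dot u (cross u v) = 0.
Proof. by rewrite dotE /cross !vecE; ring. Qed.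

Lemma dot_crossr u v : dot v (cross u v) = 0.
Proof. by rewrite dotE /cross !vecE; ring. Qed.

Lemma lagrange u v :
  dot (cross u v) (cross u v) = dot u u * dot v v - dot u v ^+ 2.
Proof. by rewrite !dotE /cross !vecE; ring. Qed.

Lemma dot_cross_cross u v w :
  dot (cross u v) (cross u w) = dot u u * dot v w - dot u v * dot u w.
Proof. by rewrite !dotE /cross !vecE; ring. Qed.

(** Clearing denominators in the expansion along [u], [v] and their cross product leaves a
    polynomial identity, valid even for dependent [u] and [v]. *)
Lemma cross_frame_expand u v x :
  dot (cross u v) (cross u v) *: x = dot x (cross u v) *: cross u v
    + (dot x u * dot v v - dot x v * dot u v) *: u
    + (dot x v * dot u u - dot x u * dot u v) *: v.
Proof.
by apply: vec3P; rewrite !dotE /cross !(vecE, mxE) /=; ring.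
Qed.

(** Cramer's rule: up to the determinant, the three cross products are the dual basis. *)
Lemma cramer3 u v w x :
  dot u (cross v w) *: x = dot x u *: cross v w + dot x v *: cross w u
    + dot x w *: cross u v.
Proof.
by apply: vec3P; rewrite !dotE /cross !(vecE, mxE) /=; ring.
Qed.

(** Both orientations are allowed, so the vectors can be permuted and negated. *)
Definition frame u v w :=
  [/\ dot u u = 1, dot v v = 1, dot w w = 1,
      dot u v = 0 & dot u w = 0 /\ dot v w = 0].

Lemma cross_frame u v :
  dot u u = 1 -> dot v v = 1 -> dot u v = 0 -> frame u v (cross u v).
Proof.
move=> u1 v1 uv; split; rewrite ?dot_crossl ?dot_crossr //.
by rewrite lagrange u1 v1 uv; ring.
Qed.

Lemma frame_cycle u v w : frame u v w -> frame v w u.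
Proof. by move=> [? ? ? uv [uw ?]]; split => //; rewrite 1?dotC ?(dotC w). Qed.

Lemma frame_basis u v w x : frame u v w ->
  x = dot x u *: u + dot x v *: v + dot x w *: w.
Proof.
move=> [u1 v1 w1 uv [uw vw]]; pose k := cross u v.
have expand z : z = dot z k *: k + dot z u *: u + dot z v *: v.
  have := cross_frame_expand u v z.
  by rewrite lagrange u1 v1 uv !mulr1 expr0n !mulr0 !subr0 scale1r.
(* Orthogonality to [u] and [v] leaves [w] a multiple of [k], with a coefficient of square 1. *)
have wk : w = dot w k *: k.
  by rewrite {1}(expand w) (dotC w u) (dotC w v) uw vw !scale0r !addr0.
have kk : dot w k ^+ 2 = 1.
  by rewrite -w1 {3}wk dotZr expr2.
rewrite {1}(expand x) -addrA addrC; congr (_ + _).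
rewrite [in RHS]wk dotZr scalerA; congr (_ *: _).
by rewrite mulrAC -expr2 kk mul1r.
Qed.

Lemma frame_dot u v w x y : frame u v w ->
  dot x y = dot x u * dot y u + dot x v * dot y v + dot x w * dot y w.
Proof.
move=> uvw; rewrite {1}(frame_basis x uvw) !dotL.
by rewrite !(dotC _ y).
Qed.

Lemma exists_unit u : u != 0 -> exists2 c, 0 < c & dot (c *: u) (c *: u) = 1.
Proof.
rewrite -dot_gt0 => u0; have s0 : Num.sqrt (dot u u) != 0 by rewrite sqrtr_eq0 -ltNge.
exists (Num.sqrt (dot u u))^-1; first by rewrite invr_gt0 sqrtr_gt0.
by rewrite !dotL -{3}(sqr_sqrtr (ltW u0)); field.
Qed.

(** [M] equals its dual cone; the equivalence alone makes it a closed convex cone containing 0. *)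
Definition selfdual (M : set 'rV[R]_3) :=
  forall x, M x <-> forall y, M y -> 0 <= dot x y.

Implicit Types A B C D M : set 'rV[R]_3.

Lemma selfdual_dot M x y : selfdual M -> M x -> M y -> 0 <= dot x y.
Proof. by move=> sM /sM; apply. Qed.

Lemma selfdualD M x y : selfdual M -> M x -> M y -> M (x + y).
Proof.
by move=> sM Mx My; apply/sM => z Mz; rewrite dotDl addr_ge0 ?(selfdual_dot sM).
Qed.

Lemma selfdualZ M c x : selfdual M -> 0 <= c -> M x -> M (c *: x).
Proof.
by move=> sM c0 Mx; apply/sM => z Mz; rewrite dotZl mulr_ge0 ?(selfdual_dot sM).
Qed.

Definition antipode M : set 'rV[R]_3 := [set x | M (- x)].

Lemma antipodeK M : antipode (antipode M) = M.
Proof. by apply/seteqP; split=> x; rewrite /antipode /= opprK. Qed.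

Lemma selfdual_antipode M : selfdual M -> selfdual (antipode M).
Proof.
move=> sM x; split=> [/sM h y My|h].
  by rewrite -[dot x y]opprK -dotNl -dotNr h.
by apply/sM => y My; rewrite dotNl -dotNr h // /antipode /= opprK.
Qed.

(** Unit length excludes 0, which lies in every self-dual cone. *)
Definition meet A B := exists2 x, dot x x = 1 & A x /\ B x.

(* For self-dual cones, a point of [A] opposite to a point of [B] is the normal
   of a plane separating [A] from [B], so this says that [A] has no interior
   point in common with [B] or with [- B]. *)
Definition nonoverlap A B := meet A B /\ meet A (antipode B).

Lemma meet_antipode A B : meet A B -> meet (antipode A) (antipode B).
Proof.
move=> [x x1 [Ax Bx]]; exists (- x); first by rewrite !dotL opprK.
by rewrite /antipode /= !opprK.
Qed.

Lemma nonoverlap_sym A B : nonoverlap A B -> nonoverlap B A.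
Proof.
move=> [[x x1 [Ax Bx]] /meet_antipode]; rewrite antipodeK => -[y y1 [Ay By]].
by split; [exists x | exists y].
Qed.

Lemma nonoverlap_antipoder A B : nonoverlap A B -> nonoverlap A (antipode B).
Proof. by move=> [AB AB']; split => //; rewrite antipodeK. Qed.

Lemma nonoverlap_antipodel A B : nonoverlap A B -> nonoverlap (antipode A) B.
Proof. by move=> /nonoverlap_sym/nonoverlap_antipoder/nonoverlap_sym. Qed.

(** By self-duality [n] is nonnegative on [A] and nonpositive on [B]. *)
Lemma separator_orthogonal A B x n : selfdual A -> selfdual B ->
  A n -> B (- n) -> A x -> B x -> dot n x = 0.
Proof.
move=> sA sB An Bn Ax Bx; apply/eqP; rewrite eq_le -oppr_ge0 -dotNl.
by rewrite (selfdual_dot sB) // (selfdual_dot sA).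
Qed.

(* In a plane, unit vectors orthogonal to the same [(a, b)] and lying on
   different sides of the second axis are opposite. *)
Lemma opposite_normals (a b v1 v2 w1 w2 : R) : b != 0 ->
  v1 * a + v2 * b = 0 -> w1 * a + w2 * b = 0 -> v1 <= 0 -> 0 <= w1 ->
  v1 * v1 + v2 * v2 = 1 -> w1 * w1 + w2 * w2 = 1 ->
  v1 * w1 + v2 * w2 < 0.
Proof.
move=> b0 va wa v1le w1ge vv ww.
have v2E : v2 = - v1 * a / b by rewrite -[v2](mulfK b0); congr (_ / _); lra.
have w2E : w2 = - w1 * a / b by rewrite -[w2](mulfK b0); congr (_ / _); lra.
have v1n : v1 < 0.
  rewrite lt_neqAle v1le andbT; apply/eqP => v10; move: vv.
  by rewrite v2E v10; lra.
have w1p : 0 < w1.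
  rewrite lt_neqAle w1ge andbT; apply/eqP => w10; move: ww.
  by rewrite w2E -w10; lra.
have -> : v1 * w1 + v2 * w2 = (v1 * w1) * (1 + (a / b) ^+ 2).
  by rewrite v2E w2E; field.
by rewrite nmulr_rlt0 ?nmulr_rlt0 // ltr_pwDl ?sqr_ge0.
Qed.

(** * A cone that crosses the plane of two vectors shared by two others *)

Section Quadrant.
Variables (A B D : set 'rV[R]_3) (n p r y y' : 'rV[R]_3).
Hypotheses (sA : selfdual A) (sB : selfdual B) (sD : selfdual D).
Hypotheses (noAD : nonoverlap A D) (noBD : nonoverlap B D).
Hypotheses (npr : frame n p r) (An : A n) (Bn : B (- n)) (Ap : A p) (Bp : B p).
Hypotheses (Dy : D y) (Dy' : D y') (yr : dot y r < 0) (y'r : 0 < dot y' r).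

(** A positive multiple of the point where the segment from [y] to [y'] crosses the plane of [n] and
    [p]. *)
Let z := dot y' r *: y - dot y r *: y'.

Let Dz : D z.
Proof.
rewrite /z -scaleNr; apply: selfdualD => //; apply: selfdualZ => //.
  exact: ltW.
by rewrite oppr_ge0 ltW.
Qed.

Let zE : z = dot z n *: n + dot z p *: p.
Proof.
rewrite {1}(frame_basis z npr) (_ : dot z r = 0) ?scale0r ?addr0 //.
by rewrite /z !dotL; ring.
Qed.

(* A separator of [M] and [D] is orthogonal to every point of [M] that lies
   between [y] and [y'], hence to [y]. *)
Let separator M w : selfdual M -> M w -> D (- w) -> M z ->
  dot w z = 0 /\ dot w y = 0.
Proof.
move=> sM Mw Dw Mz; have wz := separator_orthogonal sM sD Mw Dw Mz Dz.
split=> //; have := selfdual_dot sD Dw Dy; have := selfdual_dot sD Dw Dy'.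
move: yr y'r wz; rewrite /z !dotL => yr_ y'r_ wz; nra.
Qed.

(** The signs put [z] in [A], so a separator [w] of [A] and [D] is orthogonal to [z] and [y]. Since
    [w] has nonnegative products with [n] and [p], either [z] lies on one of these axes or [w] is
    parallel to [r], which [y] rules out. On an axis [z] also lies in [B] or [- B], and the
    separator of that cone from [D] has a negative product with [w], although the opposites of both
    lie in [D]. *)
Lemma quadrant_axis : 0 <= dot z n -> 0 <= dot z p -> False.
Proof.
move=> zn zp; have [n1 p1 r1 np [nr pr]] := npr.
have Az : A z by rewrite zE; apply: selfdualD => //; apply: selfdualZ.
(* If [z = 0], its product with [y] is a sum of nonnegative terms, which forces [y = 0]. *)
have z0 : ~ (dot z n = 0 /\ dot z p = 0).
  move=> [zn0 zp0]; have := selfdual_dot sD Dy Dy'; have := dot_ge0 y.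
  have : dot z y = 0 by rewrite zE zn0 zp0 !scale0r addr0 dot0l.
  move: yr y'r; rewrite /z !dotL (dotC y' y) => yr_ y'r_ zy yy yy'.
  have /eqP : dot y y = 0 by nra.
  by rewrite dot_eq0 => /eqP y0; move: yr; rewrite y0 dot0l ltxx.
have [_ [w w1 [Aw Dw]]] := noAD; have [wz wy] := separator sA Aw Dw Az.
have wn := selfdual_dot sA Aw An; have wp := selfdual_dot sA Aw Ap.
move/eqP: wz; rewrite zE dotDr !dotZr paddr_eq0 ?mulr_ge0 //.
move=> /andP[/eqP wzn /eqP wzp].
have yr0 : dot y r != 0 by rewrite lt_eqF.
have [zn0|zn0] := eqVneq (dot z n) 0.
  have zp0 : dot z p != 0 by apply/eqP => zp0; apply: z0.
  have wp0 : dot w p = 0 by move/eqP: wzp; rewrite mulf_eq0 (negPf zp0) => /eqP.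
  have Bz : B z by rewrite zE zn0 scale0r add0r; apply: selfdualZ.
  have [_ [v v1 [Bv Dv]]] := noBD; have [vz vy] := separator sB Bv Dv Bz.
  have vp0 : dot v p = 0.
    move/eqP: vz; rewrite zE zn0 scale0r add0r dotZr mulf_eq0 (negPf zp0).
    by move/eqP.
  have := selfdual_dot sB Bv Bn; rewrite dotNr oppr_ge0 => vn.
  have vw := selfdual_dot sD Dv Dw; rewrite !dotL opprK in vw.
  have := opposite_normals yr0 (v1 := dot v n) (v2 := dot v r)
    (w1 := dot w n) (w2 := dot w r) (a := dot y n).
  move: v1 w1 vy wy vw.
  rewrite (frame_dot v v npr) (frame_dot w w npr) (frame_dot v y npr).
  rewrite (frame_dot w y npr) (frame_dot v w npr) vp0 wp0 !mul0r !addr0.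
  by move=> v1 w1 vy wy vw /(_ vy wy vn wn v1 w1); rewrite ltNge vw.
have wn0 : dot w n = 0 by move/eqP: wzn; rewrite mulf_eq0 (negPf zn0) => /eqP.
have [zp0|zp0] := eqVneq (dot z p) 0; last first.
  have wp0 : dot w p = 0 by move/eqP: wzp; rewrite mulf_eq0 (negPf zp0) => /eqP.
  move: w1 wy; rewrite (frame_dot w w npr) (frame_dot w y npr) wn0 wp0 !mul0r !add0r => w1 /eqP.
  rewrite mulf_eq0 (negPf yr0) orbF => /eqP wr0; move: w1.
  by rewrite wr0 mul0r => /eqP; rewrite eq_sym oner_eq0.
have Bz : antipode B z.
  rewrite zE zp0 scale0r addr0 /antipode /= -scalerN; exact: selfdualZ.
have [v [v1 Bv Dv]] : exists v, [/\ dot v v = 1, antipode B v & D (- v)].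
  have [[v v1 [Bv Dv]] _] := noBD.
  by exists (- v); rewrite /antipode /= !opprK dotNl dotNr opprK.
have [vz vy] := separator (selfdual_antipode sB) Bv Dv Bz.
have vn0 : dot v n = 0.
  move/eqP: vz; rewrite zE zp0 scale0r addr0 dotZr mulf_eq0 (negPf zn0).
  by move/eqP.
have := selfdual_dot sB Bv Bp; rewrite dotNl oppr_ge0 => vp.
have vw := selfdual_dot sD Dv Dw; rewrite !dotL opprK in vw.
have := opposite_normals yr0 (v1 := dot v p) (v2 := dot v r)
  (w1 := dot w p) (w2 := dot w r) (a := dot y p).
move: v1 w1 vy wy vw.
rewrite (frame_dot v v npr) (frame_dot w w npr) (frame_dot v y npr).
rewrite (frame_dot w y npr) (frame_dot v w npr) vn0 wn0 !mul0r !add0r.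
by move=> v1 w1 vy wy vw /(_ vy wy vp wp v1 w1); rewrite ltNge vw.
Qed.

End Quadrant.

Lemma frame_oppl u v w : frame u v w -> frame (- u) v w.
Proof.
move=> [u1 v1 w1 uv [uw vw]].
by split; rewrite ?dotNl ?dotNr ?opprK // ?uv ?uw ?oppr0.
Qed.

Definition line_meets M x := M x \/ M (- x).

(* The plane orthogonal to [r] is covered by [A], [B] and their antipodes, so
   it supports [D]. *)
Lemma third_axis A B D n p r : selfdual A -> selfdual B -> selfdual D ->
  nonoverlap A D -> nonoverlap B D -> frame n p r ->
  A n -> B (- n) -> A p -> B p -> line_meets D r.
Proof.
move=> sA sB sD noAD noBD npr An Bn Ap Bp; apply: contrapT => Dr.
have side x : ~ D x -> exists2 y, D y & dot y x < 0.
  move=> Dx; apply: contrapT => h; apply/Dx/sD => y Dy.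
  by rewrite dotC leNgt; apply/negP => yx; apply: h; exists y.
have [y Dy yr] := side r (fun h => Dr (or_introl h)).
have [y' Dy' y'r] := side (- r) (fun h => Dr (or_intror h)).
rewrite dotNr oppr_lt0 in y'r.
pose z := dot y' r *: y - dot y r *: y'.
(* The four quadrants of the plane lie in [A], [- B], [B] and [- A]; the frame is renamed
   accordingly. *)
have [zn|/ltW zn] := lerP 0 (dot z n); have [zp|/ltW zp] := lerP 0 (dot z p).
- exact: (quadrant_axis sA sB sD noAD noBD npr An Bn Ap Bp Dy Dy' yr y'r zn zp).
- apply: (quadrant_axis (selfdual_antipode sB) (selfdual_antipode sA) sD
    (nonoverlap_antipodel noBD) (nonoverlap_antipodel noAD)
    (frame_cycle (frame_cycle (frame_oppl (frame_cycle npr)))) _ _ _ _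
    Dy Dy' yr y'r zn _);
  by rewrite /antipode /= ?opprK // dotNr oppr_ge0.
- apply: (quadrant_axis sB sA sD noBD noAD (frame_oppl npr) Bn _ Bp Ap
    Dy Dy' yr y'r _ zp); by rewrite ?opprK // dotNr oppr_ge0.
- apply: (quadrant_axis (selfdual_antipode sA) (selfdual_antipode sB) sD
    (nonoverlap_antipodel noAD) (nonoverlap_antipodel noBD)
    (frame_oppl (frame_cycle (frame_cycle (frame_oppl (frame_cycle npr)))))
    _ _ _ _ Dy Dy' yr y'r _ _);
  by rewrite /antipode /= ?opprK // dotNr oppr_ge0.
Qed.

(** * A line common to four cones *)

Lemma line_meets_sign M x : line_meets M x ->
  exists2 s : R, s = 1 \/ s = -1 & M (s *: x).
Proof.
by move=> [Mx|Mx]; [exists 1; [left|rewrite scale1r]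
  | exists (-1); [right|rewrite scaleN1r]].
Qed.

Lemma line_meets_antipode M x : line_meets (antipode M) x <-> line_meets M x.
Proof. by rewrite /line_meets /antipode /= opprK; tauto. Qed.

(** Nonoverlap is invariant under the antipode, so the sign of a cone can be chosen freely; the last
    clause allows the choice to be undone. *)
Lemma orient M r : selfdual M -> line_meets M r -> exists M',
  [/\ selfdual M', M' r, forall N, nonoverlap N M -> nonoverlap N M',
      forall x, line_meets M' x -> line_meets M x &
      M' = M \/ M' = antipode M].
Proof.
move=> sM [Mr|Mr]; [exists M; split => //; by left|exists (antipode M)].
split; [exact: selfdual_antipode|exact: Mr| | |by right] => x.
  exact: nonoverlap_antipoder.
by rewrite line_meets_antipode.
Qed.

(** The normal [t] of the plane spanned by [r] and the separator [s] of [C] and [D] lies, up to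
    sign, in [A] and [B]. Because of [A] its products with [n] and [p] do not have opposite signs,
    because of [B] they do not have equal signs; so [t] is on one of the axes [n], [p], and [s] is
    on the other. That other axis is the common line. *)
Lemma common_line_oriented A B C D r :
  selfdual A -> selfdual B -> selfdual C -> selfdual D ->
  nonoverlap A C -> nonoverlap A D -> nonoverlap B C -> nonoverlap B D ->
  nonoverlap C D -> dot r r = 1 -> C r -> D r ->
  (exists n p, [/\ frame n p r, A n, B (- n), A p & B p]) ->
  exists2 q, dot q q = 1 &
    [/\ line_meets A q, line_meets B q, line_meets C q & line_meets D q].
Proof.
move=> sA sB sC sD noAC noAD noBC noBD [_ [s s1 [Cs Ds]]] r1 Cr Dr.
move=> [n [p [npr An Bn Ap Bp]]]; have [n1 p1 _ np [nr pr]] := npr.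
have sr := separator_orthogonal sC sD Cs Ds Cr Dr.
pose t := cross s r; have srt : frame s r t := cross_frame s1 r1 sr.
have At := third_axis sC sD sA (nonoverlap_sym noAC) (nonoverlap_sym noAD)
  srt Cs Ds Cr Dr.
have Bt := third_axis sC sD sB (nonoverlap_sym noBC) (nonoverlap_sym noBD)
  srt Cs Ds Cr Dr.
have [_ _ t1 _ [st rt]] := srt.
have /eqP : dot t n * dot t p = 0.
  have t_ge0 : 0 <= dot t n * dot t p.
    case: At => At; have := selfdual_dot sA At An; have := selfdual_dot sA At Ap;
      rewrite ?dotNl ?oppr_ge0; nra.
  have t_le0 : dot t n * dot t p <= 0.
    case: Bt => Bt; have := selfdual_dot sB Bt Bn; have := selfdual_dot sB Bt Bp;
      rewrite ?dotNl ?dotNr ?opprK ?oppr_ge0; nra.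
  by apply/eqP; rewrite eq_le t_ge0 t_le0.
have meets q : dot q q = 1 -> dot s q != 0 -> s = dot s q *: q ->
    line_meets C q /\ line_meets D q.
  move=> q1 sq0 sE; have : dot s q ^+ 2 == 1.
    by rewrite -s1 [X in _ == dot _ X]sE dotZr expr2.
  rewrite sqrf_eq1 => /orP[]/eqP sq; move: sE; rewrite sq ?scale1r ?scaleN1r => sE.
  - by rewrite /line_meets -sE; tauto.
  - by rewrite /line_meets -sE -{2}[q]opprK -sE; tauto.
rewrite mulf_eq0 => /orP[]/eqP t0.
- have tE := frame_basis t npr; rewrite t0 (dotC t r) rt !scale0r add0r addr0 in tE.
  have sp : dot s p = 0.
    have tp0 : dot t p != 0.
      apply/eqP => tp; move: tE; rewrite tp scale0r => tE.
      by move/eqP: t1; rewrite tE dot0l eq_sym oner_eq0.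
    move: st; rewrite tE dotZr => /eqP.
    by rewrite mulf_eq0 (negPf tp0) => /eqP.
  have sE := frame_basis s npr; rewrite sp sr !scale0r !addr0 in sE.
  have [|Cn Dn] := meets n n1 _ sE.
    apply/eqP => sn; move: sE; rewrite sn scale0r => sE.
    by move/eqP: s1; rewrite sE dot0l eq_sym oner_eq0.
  by exists n => //; split=> //; [left|right].
- have tE := frame_basis t npr; rewrite t0 (dotC t r) rt !scale0r !addr0 in tE.
  have sn : dot s n = 0.
    have tn0 : dot t n != 0.
      apply/eqP => tn; move: tE; rewrite tn scale0r => tE.
      by move/eqP: t1; rewrite tE dot0l eq_sym oner_eq0.
    move: st; rewrite tE dotZr => /eqP.
    by rewrite mulf_eq0 (negPf tn0) => /eqP.
  have sE := frame_basis s npr; rewrite sn sr !scale0r add0r addr0 in sE.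
  have [|Cp Dp] := meets p p1 _ sE.
    apply/eqP => sp; move: sE; rewrite sp scale0r => sE.
    by move/eqP: s1; rewrite sE dot0l eq_sym oner_eq0.
  by exists p => //; split=> //; left.
Qed.

Lemma common_line A B C D :
  selfdual A -> selfdual B -> selfdual C -> selfdual D ->
  nonoverlap A B -> nonoverlap A C -> nonoverlap A D ->
  nonoverlap B C -> nonoverlap B D -> nonoverlap C D ->
  exists2 q, dot q q = 1 &
    [/\ line_meets A q, line_meets B q, line_meets C q & line_meets D q].
Proof.
move=> sA sB sC sD [[p p1 [Ap Bp]] [n n1 [An Bn]]] noAC noAD noBC noBD noCD.
have np := separator_orthogonal sA sB An Bn Ap Bp.
pose r := cross n p; have npr : frame n p r := cross_frame n1 p1 np.
have [_ _ r1 _ _] := npr.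
have [C' [sC' C'r noC' C'C _]] :=
  orient sC (third_axis sA sB sC noAC noBC npr An Bn Ap Bp).
have [D' [sD' D'r noD' D'D _]] :=
  orient sD (third_axis sA sB sD noAD noBD npr An Bn Ap Bp).
have noCD' : nonoverlap C' D'.
  exact/noD'/nonoverlap_sym/noC'/nonoverlap_sym.
have np_ex : exists n p, [/\ frame n p r, A n, B (- n), A p & B p].
  by exists n, p.
have [q q1 [Aq Bq Cq Dq]] := common_line_oriented sA sB sC' sD' (noC' _ noAC)
  (noD' _ noAD) (noC' _ noBC) (noD' _ noBD) noCD' r1 C'r D'r np_ex.
by exists q => //; split; auto.
Qed.

(** * An orthonormal basis inside a cone *)

Lemma frame_perp0 u v w x : frame u v w ->
  dot x u = 0 -> dot x v = 0 -> dot x w = 0 -> x = 0.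
Proof.
by move=> uvw xu xv xw; rewrite (frame_basis x uvw) xu xv xw !scale0r !addr0.
Qed.

Lemma frame_not_shared A B u v w : selfdual A -> selfdual B ->
  nonoverlap A B -> frame u v w -> A u -> A v -> A w -> B u -> B v -> ~ B w.
Proof.
move=> sA sB [_ [n n1 [An Bn]]] uvw Au Av Aw Bu Bv Bw.
move/eqP: n1; rewrite (frame_perp0 uvw (x := n)) ?dot0l 1?eq_sym ?oner_eq0 //;
  exact: (separator_orthogonal sA sB An Bn).
Qed.

(** The separators [a], [b], [c] of [A] from the other cones are orthogonal to [q]; two orthogonal
    ones complete [q] to a frame in [A]. Otherwise their products are all positive, which is refuted
    by comparing the signs with which their quarter turns about [q] lie in [B], [C] and [D]. *)
Lemma frame_oriented A B C D q : selfdual A -> selfdual B -> selfdual C ->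
  selfdual D -> nonoverlap A B -> nonoverlap A C -> nonoverlap A D ->
  nonoverlap B C -> nonoverlap B D -> nonoverlap C D ->
  dot q q = 1 -> A q -> B q -> C q -> D q ->
  exists u v w, [/\ frame u v w, A u, A v & A w].
Proof.
move=> sA sB sC sD noAB noAC noAD noBC noBD noCD q1 Aq Bq Cq Dq.
have [[_ [a a1 [Aa Ba]]] [_ [b b1 [Ab Cb]]] [_ [c c1 [Ac Dc]]]] :=
  And3 noAB noAC noAD.
have aq := separator_orthogonal sA sB Aa Ba Aq Bq.
have bq := separator_orthogonal sA sC Ab Cb Aq Cq.
have cq := separator_orthogonal sA sD Ac Dc Aq Dq.
have ab_ge0 := selfdual_dot sA Aa Ab; have ac_ge0 := selfdual_dot sA Aa Ac.
have bc_ge0 := selfdual_dot sA Ab Ac.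
have planar x y : dot x x = 1 -> dot y y = 1 -> dot x q = 0 -> dot y q = 0 ->
    A x -> A y -> dot x y = 0 -> exists u v w, [/\ frame u v w, A u, A v & A w].
  by move=> *; exists q, x, y; split=> //; split; rewrite 1?(dotC q).
have [ab0|ab0] := eqVneq (dot a b) 0; first exact: (planar a b).
have [ac0|ac0] := eqVneq (dot a c) 0; first exact: (planar a c).
have [bc0|bc0] := eqVneq (dot b c) 0; first exact: (planar b c).
have {ab_ge0 ab0} ab_gt0 : 0 < dot a b by rewrite lt0r ab0.
have {ac_ge0 ac0} ac_gt0 : 0 < dot a c by rewrite lt0r ac0.
have {bc_ge0 bc0} bc_gt0 : 0 < dot b c by rewrite lt0r bc0.
exfalso.
have turn x : dot x x = 1 -> dot x q = 0 -> frame x q (cross q x).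
  move=> x1 xq; have [? ? ? ? []] := cross_frame q1 x1 (etrans (dotC q x) xq).
  by split.
pose J := cross q; have [aF bF cF] := And3 (turn a a1 aq) (turn b b1 bq) (turn c c1 cq).
have [d d1 CJa] := line_meets_sign
  (third_axis sA sB sC noAC noBC aF Aa Ba Aq Bq).
have [d' d'1 DJa] := line_meets_sign
  (third_axis sA sB sD noAD noBD aF Aa Ba Aq Bq).
have [e e1 BJb] := line_meets_sign
  (third_axis sA sC sB noAB (nonoverlap_sym noBC) bF Ab Cb Aq Cq).
have [e' e'1 DJb] := line_meets_sign
  (third_axis sA sC sD noAD noCD bF Ab Cb Aq Cq).
have [f f1 BJc] := line_meets_sign
  (third_axis sA sD sB noAB (nonoverlap_sym noBD) cF Ac Dc Aq Dq).
have [f' f'1 CJc] := line_meets_sign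
  (third_axis sA sD sC noAC (nonoverlap_sym noCD) cF Ac Dc Aq Dq).
have JJ x y : dot x q = 0 -> dot y q = 0 -> dot (J x) (J y) = dot x y.
  by move=> xq yq; rewrite dot_cross_cross q1 (dotC q x) xq mul0r mul1r subr0.
have JC x y : dot x (J y) = - dot y (J x).
  by rewrite !dotE /J /cross !vecE; ring.
have J_eq0 x y : dot x x = 1 -> dot y y = 1 -> dot x q = 0 -> dot y q = 0 ->
    0 < dot x y -> dot x (J y) = 0 -> x = y.
  move=> x1 y1 xq yq xy xJy; have xE := frame_basis x (turn y y1 yq).
  rewrite xq xJy !scale0r !addr0 in xE.
  have : dot x y ^+ 2 == 1 by rewrite -x1 [X in _ == dot X _]xE dotZl dotC.
  rewrite sqrf_eq1 => /orP[]/eqP xy1; first by rewrite xE xy1 scale1r.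
  by move: xy; rewrite xy1 oppr_gt0 ltNge ler01.
have sgn_eq (s t z : R) : s = 1 \/ s = -1 -> t = 1 \/ t = -1 -> 0 < z ->
    0 <= s * (t * z) -> s = t.
  by move=> [->|->] [->|->] z0 //; lra.
(* Each of [B], [C], [D] contains two signed quarter turns. Their product is nonnegative, so the
   signs agree and each cone has a single sign. *)
have ef : e = f.
  apply: (sgn_eq _ _ _ e1 f1 bc_gt0); rewrite -(JJ _ _ bq cq) -dotZr -dotZl.
  exact: (selfdual_dot sB).
have df : d = f'.
  apply: (sgn_eq _ _ _ d1 f'1 ac_gt0); rewrite -(JJ _ _ aq cq) -dotZr -dotZl.
  exact: (selfdual_dot sC).
have de : d' = e'.
  apply: (sgn_eq _ _ _ d'1 e'1 ab_gt0); rewrite -(JJ _ _ aq bq) -dotZr -dotZl.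
  exact: (selfdual_dot sD).
subst f f' e'.
(* If two cones have the same sign, antisymmetry of [J] makes both products vanish; then [x = y],
   and the cones share a whole frame. *)
have clash X Y x y (s : R) : selfdual X -> selfdual Y -> nonoverlap X Y ->
    X q -> Y q -> dot x x = 1 -> dot y y = 1 -> dot x q = 0 -> dot y q = 0 ->
    0 < dot x y -> s = 1 \/ s = -1 ->
    X (- x) -> Y (- y) -> X (s *: J y) -> Y (s *: J x) -> False.
  move=> sX sY noXY Xq Yq x1 y1 xq yq xy s1 Xx Yy XJ YJ.
  have := selfdual_dot sX Xx XJ; have := selfdual_dot sY Yy YJ.
  rewrite !dotNl !dotZr (JC y) => h1 h2.
  have xJy : dot x (J y) = 0 by case: s1 h1 h2 => ->; lra.
  have exy := J_eq0 x y x1 y1 xq yq xy xJy; subst y.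
  have [_ _ J1 _ [xJ qJ]] := turn x x1 xq.
  have F : frame q (- x) (s *: J x).
    split; rewrite ?dotNl ?dotNr ?dotZl ?dotZr ?opprK ?J1 ?qJ ?xJ
      ?(dotC q x) ?xq ?mulr0 ?oppr0 //.
    by case: s1 => ->; ring.
  exact: (frame_not_shared sX sY noXY F Xq Xx XJ Yq Yy YJ).
(* Of three signs, two are equal. *)
have [de|de] := eqVneq d e.
  by apply: (clash B C a b e) => //; rewrite -de.
have [d'e|d'e] := eqVneq d' e.
  by apply: (clash B D a c e) => //; rewrite -d'e.
have dd' : d = d'.
  by move: de d'e; case: d1 => ->; case: d'1 => ->; case: e1 => ->;
    rewrite ?eqxx.
by apply: (clash C D b c d) => //; rewrite dd'.
Qed.

Lemma contains_frame A B C D :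
  selfdual A -> selfdual B -> selfdual C -> selfdual D ->
  nonoverlap A B -> nonoverlap A C -> nonoverlap A D ->
  nonoverlap B C -> nonoverlap B D -> nonoverlap C D ->
  exists u v w, [/\ frame u v w, A u, A v & A w].
Proof.
move=> sA sB sC sD noAB noAC noAD noBC noBD noCD.
have [q q1 [Aq Bq Cq Dq]] :=
  common_line sA sB sC sD noAB noAC noAD noBC noBD noCD.
have [A' [sA' A'q noA' _ A'E]] := orient sA Aq.
have [B' [sB' B'q noB' _ _]] := orient sB Bq.
have [C' [sC' C'q noC' _ _]] := orient sC Cq.
have [D' [sD' D'q noD' _ _]] := orient sD Dq.
have both X X' Y Y' (noX : forall N, nonoverlap N X -> nonoverlap N X')
    (noY : forall N, nonoverlap N Y -> nonoverlap N Y') :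
  nonoverlap X Y -> nonoverlap X' Y'.
  by move=> noXY; apply/noY/nonoverlap_sym/noX/nonoverlap_sym.
have [u [v [w [F A'u A'v A'w]]]] := frame_oriented sA' sB' sC' sD'
  (both _ _ _ _ noA' noB' noAB) (both _ _ _ _ noA' noC' noAC)
  (both _ _ _ _ noA' noD' noAD) (both _ _ _ _ noB' noC' noBC)
  (both _ _ _ _ noB' noD' noBD) (both _ _ _ _ noC' noD' noCD) q1 A'q B'q C'q D'q.
case: A'E A'u A'v A'w => -> Au Av Aw; first by exists u, v, w.
exists (- u), (- v), (- w); split=> //.
have [u1 v1 w1 uv [uw vw]] := F.
by split; rewrite !dotNl !dotNr !opprK.
Qed.

End Vectors.

(** * Maximal acute sets *)

Section Zorn.
Context {R : realType}.

(** A vector with nonnegative products against a maximal set can be added to it, its square being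
    nonnegative. *)
Lemma selfdual_extension (T : set 'rV[R]_3) :
  (forall x y, T x -> T y -> 0 <= dot x y) ->
  exists2 M, selfdual M & T `<=` M.
Proof.
move=> Tpos.
(* With [T] built into [P], the union of the empty chain is admissible. *)
pose P (A : set 'rV[R]_3) := forall x y, (T `|` A) x -> (T `|` A) y -> 0 <= dot x y.
have [F FP Ftot|A [PA Amax]] := @Zorn_bigcup _ P.
  have pair x y X Y : F X -> F Y -> X x -> Y y -> 0 <= dot x y.
    move=> FX FY Xx Yy; have [XY|YX] := Ftot _ _ FX FY.
      by apply: (FP _ FY); right => //; exact: XY.
    by apply: (FP _ FX); right => //; exact: YX.
  move=> x y [Tx|[X FX Xx]] [Ty|[Y FY Yy]]; first exact: Tpos.
  - by apply: (FP _ FY); [left|right].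
  - by apply: (FP _ FX); [right|left].
  - exact: pair FX FY Xx Yy.
have TA : T `<=` A.
  apply: contrapT => TA; apply: (Amax (T `|` A)).
    by split; [move=> x; right|move=> h; apply: TA => x Tx; apply: h; left].
  by rewrite /P setUA setUid.
exists A => // x; split=> [Ax y Ay|h]; first by apply: PA; right.
apply: contrapT => Ax; apply: (Amax (A `|` [set x])).
  by split; [move=> y; left|move=> h'; apply: Ax; apply: h'; right].
have A' y : (T `|` (A `|` [set x])) y -> A y \/ y = x.
  by move=> [/TA|[]]; [left|left|right].
move=> y z /A'[Ay|->] /A'[Az|->].
- by apply: PA; right.
- by rewrite dotC h.
- exact: h.
- exact: dot_ge0.
Qed.

(** A vector orthogonal to all of [M] belongs to [M], hence is orthogonal to itself. *)
Lemma selfdual_nonperp (M : set 'rV[R]_3) x : selfdual M -> x != 0 ->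
  exists2 y, M y & dot x y != 0.
Proof.
move=> sM x0; apply: contrapT => h.
have xM y : M y -> dot x y = 0.
  by move=> My; apply/eqP; apply: contrapT => /negP xy; apply: h; exists y.
have Mx : M x by apply/sM => y /xM->.
by move/eqP: (xM _ Mx); rewrite dot_eq0 (negPf x0).
Qed.

Lemma exists_orthogonal (u : 'rV[R]_3) : exists2 x, dot x x = 1 & dot x u = 0.
Proof.
suff [x x0 xu] : exists2 x, x != 0 & dot x u = 0.
  have [c _ cx] := exists_unit x0.
  by exists (c *: x) => //; rewrite dotZl xu mulr0.
(* If this cross product vanishes, [u] is a multiple of the first axis and the second axis
   serves. *)
have [u1|u1] := eqVneq (cross (vec 1 0 0) u) 0; last first.
  by exists (cross (vec 1 0 0) u) => //; rewrite dotC dot_crossr.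
exists (vec 0 1 0).
  by apply/eqP => /rowP/(_ 1); rewrite vecE mxE => /eqP; rewrite oner_eq0.
move/rowP: u1 => /(_ 2%:R); rewrite /cross !vecE mxE dotE !vecE; lra.
Qed.

Lemma selfdual_basis (M : set 'rV[R]_3) : selfdual M ->
  exists u v w, [/\ M u, M v, M w & dot u (cross v w) != 0].
Proof.
move=> sM; have e0 : vec 1 0 0 != 0 :> 'rV[R]_3.
  by apply/eqP => /rowP/(_ 0); rewrite vecE mxE => /eqP; rewrite oner_eq0.
have [u Mu u0] := selfdual_nonperp sM e0.
have {}u0 : u != 0 by apply: contra_neq u0 => ->; rewrite dotC dot0l.
have [x x1 xu] := exists_orthogonal u; have x0 := dot_unit_neq0 x1.
have [v Mv xv] := selfdual_nonperp sM x0.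
have uv : cross u v != 0.
  apply: contra_neq xv => uv; have := dot_cross_cross u x v.
  rewrite uv (dotC (cross u x)) dot0l (dotC u x) xu mul0r subr0 => /esym/eqP.
  by rewrite mulf_eq0 dot_eq0 (negPf u0) => /eqP.
have [w Mw uvw] := selfdual_nonperp sM uv.
exists w, u, v; split=> //; by rewrite dotC.
Qed.

(** Take the sum of a basis contained in [M]: by Cramer's rule each coordinate of a point of [M] is
    a combination of its three nonnegative products with that basis. The estimate bounds the slice
    of [M] where the functional is 1. *)
Lemma selfdual_gauge (M : set 'rV[R]_3) : selfdual M ->
  exists x, exists2 c : R, 0 < c &
    forall u, M u -> forall k, c * `|u 0 k| <= dot x u.
Proof.
move=> sM; have [u [v [w [Mu Mv Mw d0]]]] := selfdual_basis sM.
set d := dot u _ in d0.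
pose B := \sum_k (`|cross v w 0 k| + `|cross w u 0 k| + `|cross u v 0 k|).
have B0 : 0 <= B by apply: sumr_ge0 => k _; rewrite !addr_ge0.
exists (u + v + w), (`|d| / (1 + B)).
  by rewrite divr_gt0 ?normr_gt0 // ltr_pwDl.
move=> x Mx k; rewrite mulrAC ler_pdivrMr ?ltr_pwDl // -normrM.
have -> : d * x 0 k = dot x u * cross v w 0 k + dot x v * cross w u 0 k
    + dot x w * cross u v 0 k.
  by have /rowP/(_ k) := cramer3 u v w x; rewrite !mxE.
have [xu xv xw] := And3 (selfdual_dot sM Mx Mu) (selfdual_dot sM Mx Mv)
  (selfdual_dot sM Mx Mw).
set s := dot (u + v + w) x.
have sE : s = dot x u + dot x v + dot x w by rewrite /s dotC !dotDr.
have Bk : `|cross v w 0 k| + `|cross w u 0 k| + `|cross u v 0 k| <= 1 + B.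
  rewrite /B (bigD1 k) //= addrCA lerDl addr_ge0 //.
  by apply: sumr_ge0 => i _; rewrite !addr_ge0.
apply: le_trans (ler_wpM2l _ Bk); last by rewrite sE !addr_ge0.
rewrite !mulrDr; apply: le_trans (ler_normD _ _) _.
apply: lerD; first (apply: le_trans (ler_normD _ _) _; apply: lerD);
  by rewrite normrM ger0_norm // ler_wpM2r // sE; lra.
Qed.
End Zorn.

(** * Separation *)

Section Slab.
Context {R : realType}.
Implicit Types (A B M : set 'rV[R]_3).

Lemma continuous_dot (T : topologicalType) (f g : T -> 'rV[R]_3) :
  continuous f -> continuous g -> continuous (fun t => dot (f t) (g t)).
Proof.
move=> cf cg; rewrite (_ : (fun t => _) = fun t => f t 0 0 * g t 0 0
  + f t 0 1 * g t 0 1 + f t 0 2%:R * g t 0 2%:R); last first.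
  by apply/funext => s; rewrite dotE.
move=> t; have coord (h : T -> 'rV[R]_3) k : continuous h ->
    (fun s => h s 0 k) @ t --> h t 0 k.
  move=> ch; apply: (@continuous_comp _ _ _ h (fun m : 'rV[R]_3 => m 0 k)).
    exact: ch.
  exact: coord_continuous.
have cont k : (fun t => f t 0 k * g t 0 k) @ t --> f t 0 k * g t 0 k.
  by apply: cvgM; exact: coord.
by apply: cvgD; [apply: cvgD|]; exact: cont.
Qed.

Lemma selfdual_closed (T : topologicalType) (f : T -> 'rV[R]_3) M :
  selfdual M -> continuous f -> closed (f @^-1` M).
Proof.
move=> sM cf; rewrite (_ : f @^-1` M =
    \bigcap_(y in M) [set t | 0 <= dot (f t) y]).
  apply: closed_bigI => y _.
  apply: (@preimage_closed _ _ (fun t => dot (f t) y) [set x | 0 <= x]).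
    by move=> t _; apply: continuous_dot => //; exact: cst_continuous.
  exact: closed_ge.
by apply/seteqP; split=> t /=; rewrite sM.
Qed.

Lemma box_compact (c : R) :
  compact [set u : 'rV[R]_3 | forall k, `|u 0 k| <= c].
Proof.
have := @rV_compact R 3 (fun=> `[- c, c]%classic) (fun=> @segment_compact _ _ _).
congr compact; apply/seteqP; split => u /= h k; have := h k;
  by rewrite in_itv /= ler_norml.
Qed.

Lemma dot_sqrDZ u v (c : R) : dot (u + c *: v) (u + c *: v) =
  dot u u + c * (2 * dot u v + c * dot v v).
Proof. by rewrite !dotL (dotC v u); ring. Qed.

(* The nearest point [h] to the origin in a compact base of [A + B] is the
   normal of a plane bounding both cones, unless [h = 0]. *)
Lemma opposite_or_slab A B : selfdual A -> selfdual B ->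
  (exists2 n, dot n n = 1 & A n /\ B (- n)) \/
  (exists x, exists2 e : R, 0 < e &
    forall u, dot u u = 1 -> A u \/ B u -> e <= dot x u).
Proof.
move=> sA sB; have [[x [c c0 xA]] [y [d d0 yB]]] :=
  (selfdual_gauge sA, selfdual_gauge sB).
(* The pairs normalised by the sum of the two gauges; each gauge bounds its component, so [Q] is
   compact. *)
pose Q : set ('rV[R]_3 * 'rV[R]_3) :=
  [set p | [/\ A p.1, B p.2 & dot x p.1 + dot y p.2 = 1]].
have sub0 M z : selfdual M -> M z -> M 0.
  by move=> sM Mz; rewrite -(scale0r z); exact: selfdualZ.
have [a0 Aa0] : exists a, A a.
  by have [u [v [w [Au _ _ _]]]] := selfdual_basis sA; exists u.
have [b0 Bb0] : exists b, B b.
  by have [u [v [w [Bu _ _ _]]]] := selfdual_basis sB; exists u.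
have A0 := sub0 _ _ sA Aa0; have B0 := sub0 _ _ sB Bb0.
have Ax u : A u -> 0 <= dot x u.
  by move=> Au; apply: le_trans (xA _ Au 0); rewrite mulr_ge0 // ltW.
have By u : B u -> 0 <= dot y u.
  by move=> Bu; apply: le_trans (yB _ Bu 0); rewrite mulr_ge0 // ltW.
have Qclosed : closed Q.
  rewrite (_ : Q = fst @^-1` A `&` (snd @^-1` B `&`
    (fun p => dot x p.1 + dot y p.2) @^-1` [set 1])).
    apply: closedI; first by apply: selfdual_closed => // ?; exact: cvg_fst.
    apply: closedI; first by apply: selfdual_closed => // ?; exact: cvg_snd.
    apply: preimage_closed; last exact: closed_eq.
    move=> p _; apply: cvgD; apply: continuous_dot => [?|?]; 
      by [exact: cvg_cst|exact: cvg_fst|exact: cvg_snd].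
  by apply/seteqP; split=> p /=; [case|move=> [? []]].
have Qcompact : compact Q.
  apply: (subclosed_compact Qclosed
    (compact_setX (@box_compact c^-1) (@box_compact d^-1))).
  move=> [u v] [/= Au Bv uv]; split=> k /=.
    rewrite -(ler_pM2l c0) divff ?gt_eqF //.
    by apply: le_trans (xA _ Au k) _; rewrite -uv lerDl By.
  rewrite -(ler_pM2l d0) divff ?gt_eqF //.
  by apply: le_trans (yB _ Bv k) _; rewrite -uv lerDr Ax.
have inA u : A u -> 0 < dot x u -> Q ((dot x u)^-1 *: u, 0).
  move=> Au xu; split => //=; first by apply: selfdualZ => //; rewrite invr_ge0 Ax.
  by rewrite dotZr mulVf ?gt_eqF // dotC dot0l addr0.
have inB u : B u -> 0 < dot y u -> Q (0, (dot y u)^-1 *: u).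
  move=> Bu yu; split => //=; first by apply: selfdualZ => //; rewrite invr_ge0 By.
  by rewrite dotZr mulVf ?gt_eqF // dotC dot0l add0r.
(* Three squares of at most 1/4 cannot add up to 1. *)
have big_coord u : dot u u = 1 -> exists k, 1 / 2 <= `|u 0 k|.
  move=> u1; apply: contrapT => h.
  have lt k : `|u 0 k| < 1 / 2 by rewrite ltNge; apply/negP => ?; apply: h; exists k.
  have sq k : u 0 k * u 0 k <= 1 / 4.
    by have := lt k; rewrite ltr_norml => /andP[]; nra.
  by move: u1 (sq 0) (sq 1) (sq 2%:R); rewrite dotE; lra.
have gauge u (z : R) : dot u u = 1 -> 0 < z ->
    (forall k, z * `|u 0 k| <= dot x u) -> z / 2 <= dot x u.
  move=> /big_coord[k uk] z0 /(_ k); apply: le_trans.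
  by rewrite ler_pM2l //; lra.
have gauge' u (z : R) : dot u u = 1 -> 0 < z ->
    (forall k, z * `|u 0 k| <= dot y u) -> z / 2 <= dot y u.
  move=> /big_coord[k uk] z0 /(_ k); apply: le_trans.
  by rewrite ler_pM2l //; lra.
have Q0 : Q !=set0.
  have [u [v [w [Au _ _ d1]]]] := selfdual_basis sA.
  have u0 : u != 0 by apply: contra_neq d1 => ->; rewrite dot0l.
  have [s s0 su] := exists_unit u0; have Asu : A (s *: u) by apply: selfdualZ => //; exact: ltW.
  exists ((dot x (s *: u))^-1 *: (s *: u), 0); apply: inA => //.
  by apply: lt_le_trans (gauge _ _ su c0 (xA _ Asu)); rewrite divr_gt0.
have [|[a b] /set_mem[/= Aa Bb ab] hmin] :=
    @compact_EVT_min _ R (fun p : 'rV[R]_3 * 'rV[R]_3 => dot (p.1 + p.2) (p.1 + p.2)) Q Q0 Qcompact.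
  apply: continuous_subspaceT; apply: continuous_dot => p;
    by apply: cvgD; [exact: cvg_fst|exact: cvg_snd].
(* If the minimum is 0, the pair is [(a, - a)], and the normalisation keeps [a] nonzero. *)
have [h0|h0] := eqVneq (a + b) 0.
  left; have bE : b = - a by apply/eqP; rewrite -addr_eq0 addrC h0.
  have a0' : a != 0.
    apply/eqP => a0'; move: ab; rewrite bE a0' oppr0 !(dotC _ 0) !dot0l addr0.
    by move/esym/eqP; rewrite oner_eq0.
  have [s s0 sa] := exists_unit a0'; exists (s *: a) => //; split.
    by apply: selfdualZ => //; exact: ltW.
  by rewrite -scalerN -bE; apply: selfdualZ => //; exact: ltW.
right; pose h := a + b; pose N := dot h h; have N0 : 0 < N by rewrite dot_gt0.
(* First-order condition at the minimiser: moving from [h] towards [u + v] cannot shorten it. *)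
have hQ u v : Q (u, v) -> N <= dot h (u + v).
  move=> [/= Au Bv uv]; rewrite leNgt; apply/negP => lt.
  pose k := u + v - h; have hk : dot h k < 0 by rewrite /k dotDr dotNr -/N; lra.
  have kk : 0 <= dot k k := dot_ge0 k.
  have step (t : R) : 0 <= t -> t <= 1 -> 0 <= t * (2 * dot h k + t * dot k k).
    move=> t0 t1.
    have /mem_set/hmin : Q ((1 - t) *: a + t *: u, (1 - t) *: b + t *: v).
      split => /=; try (by apply: selfdualD => //; apply: selfdualZ => //; lra).
      transitivity ((1 - t) * (dot x a + dot y b) + t * (dot x u + dot y v)).
        by rewrite !dotDr !dotZr; ring.
      by rewrite ab uv; ring.
    rewrite /= (_ : _ + _ + _ = h + t *: k); last first.
      by apply/rowP => i; rewrite /k /h !mxE; ring.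
    by rewrite -/h dot_sqrDZ lerDl.
  (* The bracket is negative at [t = 1] if [dot k k] is small, and otherwise at
     [- dot h k / dot k k], which is then below 1. *)
  have [le|gt] := lerP (dot k k) (- dot h k).
    by have := step 1 ler01 (lexx _); lra.
  pose t := - dot h k / dot k k; have kk0 : 0 < dot k k by lra.
  have t0 : 0 < t by rewrite divr_gt0 // oppr_gt0.
  have := step t (ltW t0); rewrite ler_pdivrMr // mul1r (ltW gt) => /(_ isT).
  by rewrite pmulr_rge0 // /t mulfVK ?gt_eqF //; lra.
(* A unit vector has gauge at least [c / 2] in [A] and [d / 2] in [B]; divided by its gauge it
   enters [Q], where products with [h] are at least [N]. *)
exists h, (N * Num.min (c / 2) (d / 2)).
  by rewrite mulr_gt0 // lt_min !divr_gt0.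
move=> u u1 [Au|Bu].
  have xu := gauge _ _ u1 c0 (xA _ Au).
  have xu0 : 0 < dot x u by apply: lt_le_trans xu; rewrite divr_gt0.
  have := hQ _ _ (inA _ Au xu0); rewrite addr0 dotZr mulrC ler_pdivlMr // => hu.
  apply: le_trans hu; rewrite ler_pM2l //; apply: le_trans xu.
  by rewrite ge_min lexx.
have yu := gauge' _ _ u1 d0 (yB _ Bu).
have yu0 : 0 < dot y u by apply: lt_le_trans yu; rewrite divr_gt0.
have := hQ _ _ (inB _ Bu yu0); rewrite add0r dotZr mulrC ler_pdivlMr // => hu.
apply: le_trans hu; rewrite ler_pM2l //; apply: le_trans yu.
by rewrite ge_min lexx orbT.
Qed.
End Slab.

(** * Color classes *)

Section Coloring.
Context {R : realType}.

Definition triple_nonneg (S : set 'rV[R]_3) :=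
  forall u v w, S u -> S v -> S w -> 0 <= dot u v * dot u w * dot v w.

(** Fix [w] in the class. Scaling each [u] by [dot u w] turns pairwise products into triple
    products, which are nonnegative; since [dot u w] is nonzero, the scaling can be undone up to
    sign. *)
Lemma class_cone (S : set 'rV[R]_3) :
  (forall u v, S u -> S v -> dot u v != 0) -> triple_nonneg S ->
  exists M, selfdual M /\ forall u, S u -> line_meets M u.
Proof.
move=> S0 S3; have [[w Sw]|Sempty] := pselect (exists w, S w); last first.
  have [|M sM _] := @selfdual_extension R set0; first by [].
  by exists M; split=> // u Su; case: Sempty; exists u.
have [_ _ [u Su <-] [v Sv <-]|M sM TM] :=
    @selfdual_extension R [set dot u w *: u | u in S].
  rewrite dotZl dotZr (_ : _ * _ = dot u v * dot u w * dot v w) ?S3 //; ring.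
exists M; split=> // u Su; have Mu : M (dot u w *: u) by apply: TM; exists u.
have /orP[uw|uw] : (dot u w < 0) || (0 < dot u w) by rewrite -neq_lt S0.
  right; have := selfdualZ (c := - (dot u w)^-1) sM _ Mu.
  by rewrite scalerA mulNr mulVf ?lt_eqF // scaleN1r oppr_ge0 invr_le0 ltW //; apply.
left; have := selfdualZ (c := (dot u w)^-1) sM _ Mu.
by rewrite scalerA mulVf ?gt_eqF // scale1r invr_ge0 ltW //; apply.
Qed.

Lemma two_other_colors (i j p q r : 'I_4) : i != j -> p != q ->
  p != i -> p != j -> q != i -> q != j -> r != i -> r != j -> r != q -> r = p.
Proof.
move=> ij pq pi pj qi qj ri rj rq; apply/eqP; apply: contraT => rp.
have /card_uniqP us : uniq [:: r; p; q; i; j].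
  by rewrite /= !inE !negb_or rp rq ri rj pq pi pj qi qj ij.
by have := max_card [in [:: r; p; q; i; j]]; rewrite us card_ord.
Qed.

(** The color of a direction, so that points with integer coordinates can be used without
    normalising them. *)
Definition colored (S : set 'rV[R]_3) v := exists2 c : R, 0 < c & S (c *: v).

(* On the great circle orthogonal to [x] only two colors are left, so some two
   close points [y], [z] have different ones.  Rotating by a right angle swaps
   the colors on the circle, and tilting a point slightly towards [x] does not
   change its color, but [y] and the rotation of [z] can be tilted into
   orthogonal points. *)
Lemma no_two_color_band (S : 'I_4 -> set 'rV[R]_3) (i j : 'I_4) x (e : R) :
  orthogonal_coloring S -> i != j -> dot x x = 1 -> 0 < e ->
  ~ (forall u, S i u \/ S j u -> e <= `|dot x u|).
Proof.
move=> [[Scover _ _] Sorth] ij x1 e0 slab.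
have Ssphere k u : S k u -> dot u u = 1.
  by move=> Su; have : cover [set: 'I_4] S u by [exists k]; rewrite Scover.
have color v : v != 0 -> exists k, colored (S k) v.
  move=> v0; have [c c0 cv] := exists_unit v0.
  have : @sphere2 R (c *: v) by [].
  by rewrite -Scover => -[k _ Sk]; exists k, c.
have orth k v w : colored (S k) v -> colored (S k) w -> dot v w != 0.
  move=> [c c0 Sv] [d d0 Sw]; have := Sorth _ _ _ Sv Sw.
  by apply: contra_neq => vw; rewrite dotZl dotZr vw !mulr0.
have band k v : dot x v ^+ 2 < e ^+ 2 * dot v v -> colored (S k) v ->
    k != i /\ k != j.
  move=> lt [c c0 Sv].
  suff : ~ (k = i \/ k = j).
    by move=> h; split; apply/eqP => kE; apply: h; [left|right].
  move=> kE; have : e <= `|dot x (c *: v)|.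
    by apply: slab; case: kE => <-; [left|right].
  have := Ssphere _ _ Sv; rewrite !dotL => cv ev.
  have : e ^+ 2 <= (c * dot x v) ^+ 2.
    by rewrite -[leRHS]real_normK ?num_real // !expr2 ler_pM // ltW.
  apply/negP; rewrite -ltNge exprMn.
  rewrite (_ : e ^+ 2 = c ^+ 2 * (e ^+ 2 * dot v v)).
    by rewrite ltr_pM2l // exprn_gt0.
  by rewrite -[LHS]mulr1 -cv; ring.
have [f f1 fx] := exists_orthogonal x; have xf : dot x f = 0 by rewrite dotC.
pose g := cross x f; have [_ _ g1 _ [xg fg]] := cross_frame x1 f1 xf.
rewrite -/g in g1 xg fg.
(* The points [(N - m, m)] of a segment stand for a quarter circle. The height [K] is small against
   their length, which is at least [N / sqrt 2], and [K * K = N] cancels the product [- N] of a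
   point with the quarter turn of its successor. *)
pose K := Num.bound (2 / e); pose N := (K * K)%N.
have Ke : 2 < e * K%:R.
  have /archi_boundP := ltW (divr_gt0 (ltr0n R 2) e0).
  by rewrite ltr_pdivrMr // mulrC.
have K0 : 0 < K%:R :> R by rewrite -(pmulr_rgt0 _ e0); lra.
pose v (a b c : R) := a *: f + b *: g + c *: x.
have dotv a b c a' b' c' : dot (v a b c) (v a' b' c') = a * a' + b * b' + c * c'.
  have [gf gx] : dot g f = 0 /\ dot g x = 0 by rewrite !(dotC g).
  by rewrite /v !(dotDl, dotDr, dotZl, dotZr) f1 g1 x1 fg gf xf fx xg gx; ring.
have dotxv a b c : dot x (v a b c) = c.
  by rewrite /v !dotDr !dotZr xf xg x1; ring.
pose P p m := colored (S p) (v (N%:R - m%:R) m%:R 0).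
have N_gt0 : 0 < N%:R :> R by rewrite natrM mulr_gt0.
(* The alternative [b - a = N] covers the quarter turns. *)
have bandv k a b c : 0 < a * a + b * b -> c = 0 \/ c = K%:R ->
    (a + b = N%:R \/ b - a = N%:R) ->
    colored (S k) (v a b c) -> k != i /\ k != j.
  move=> ab_gt0 cE abN; apply: band; rewrite dotxv dotv.
  case: cE => ->; first by rewrite expr0n mulr0 addr0 mulr_gt0 ?exprn_gt0.
  have ab : N%:R * N%:R <= 2 * (a * a + b * b).
    by case: abN => <-; rewrite -subr_ge0; [have := sqr_ge0 (a - b)
      | have := sqr_ge0 (a + b)]; lra.
  have : K%:R * K%:R * (2 * 2) < (K%:R * K%:R) * ((e * K%:R) * (e * K%:R)).
    by rewrite ltr_pM2l ?mulr_gt0 //; exact: ltr_pM.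
  have ee : 0 < e * e by rewrite mulr_gt0.
  have : 0 < K%:R * K%:R :> R by rewrite mulr_gt0.
  have : 0 < e * e * (K%:R * K%:R) by rewrite !mulr_gt0.
  move: ab; rewrite -(ler_pM2l ee) natrM !expr2; lra.
have vcolor a b c : 0 < a * a + b * b -> exists k, colored (S k) (v a b c).
  move=> ab; apply: color; rewrite -dot_gt0 dotv.
  by rewrite ltr_pwDl // -expr2 sqr_ge0.
have sq_gt0 (a b : R) : a + b = N%:R -> 0 < a * a + b * b.
  move=> ab; rewrite -!expr2 lt0r addr_ge0 ?sqr_ge0 // andbT.
  apply/eqP => /eqP; rewrite paddr_eq0 ?sqr_ge0 // !sqrf_eq0.
  by case/andP=> /eqP a0 /eqP b0; move: N_gt0; rewrite -ab a0 b0 addr0 ltxx.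
have [p P0] : exists p, P p 0 by apply: vcolor; apply: sq_gt0; rewrite subrK.
(* The endpoints are orthogonal, so the color [p] is lost at some step. *)
have [m [mN Pm Pm1]] : exists m, [/\ (m < N)%N, P p m & ~ P p m.+1].
  apply: contrapT => h.
  have Pall m : (m <= N)%N -> P p m.
    elim: m => // m IH mN; apply: contrapT => Pm1; apply: h; exists m.
    by split=> //; apply/IH/ltnW.
  have := orth _ _ _ P0 (Pall _ (leqnn N)); rewrite dotv subrr => /eqP; apply.
  by ring.
pose a : R := N%:R - m%:R; pose b : R := m%:R; pose a' : R := N%:R - m.+1%:R.
pose b' : R := m.+1%:R.
have abN : a + b = N%:R by rewrite subrK.
have abN' : a' + b' = N%:R by rewrite subrK.
have JN (s t : R) : s + t = N%:R -> s - - t = N%:R by rewrite opprK.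
have Jsq (s t : R) : s + t = N%:R -> 0 < - t * - t + s * s.
  by move=> st; have := sq_gt0 s t st; lra.
have [q Pq] := vcolor a' b' 0 (sq_gt0 _ _ abN').
have [r Pr] := vcolor (- b) a 0 (Jsq _ _ abN).
have [p1 Pp1] := vcolor a b K%:R (sq_gt0 _ _ abN).
have [p2 Pp2] := vcolor (- b') a' K%:R (Jsq _ _ abN').
have [pi pj] := bandv _ _ _ _ (sq_gt0 _ _ abN) (or_introl erefl)
  (or_introl abN) Pm.
have [qi qj] := bandv _ _ _ _ (sq_gt0 _ _ abN') (or_introl erefl)
  (or_introl abN') Pq.
have [ri rj] := bandv _ _ _ _ (Jsq _ _ abN) (or_introl erefl)
  (or_intror (JN _ _ abN)) Pr.
have [p1i p1j] := bandv _ _ _ _ (sq_gt0 _ _ abN) (or_intror erefl)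
  (or_introl abN) Pp1.
have [p2i p2j] := bandv _ _ _ _ (Jsq _ _ abN') (or_intror erefl)
  (or_intror (JN _ _ abN')) Pp2.
have differ k l y z : colored (S k) y -> colored (S l) z -> dot y z = 0 -> k != l.
  move=> ky lz yz; apply/eqP => kl; rewrite kl in ky.
  by move/eqP: (orth _ _ _ ky lz).
have pq : p != q by apply/eqP => pq; apply: Pm1; rewrite pq.
(* Only [p] and [q] are available. The quarter turn of the first point avoids [p], so it has color
   [q]; each tilted point is orthogonal to a point of color [q], so both have color [p]. *)
have rp : r != p by apply: differ Pr Pm _; rewrite dotv /a /b /a' /b'; ring.
have rq : r = q.
  by apply: (two_other_colors ij _ qi qj pi pj) => //; rewrite eq_sym.
have p1p : p1 = p.
  apply: (two_other_colors ij pq) => //; rewrite -rq.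
  by apply: differ Pp1 Pr _; rewrite dotv /a /b /a' /b'; ring.
have p2p : p2 = p.
  apply: (two_other_colors ij pq) => //.
  by apply: differ Pp2 Pq _; rewrite dotv /a /b /a' /b'; ring.
subst p1 p2; have /eqP[] := orth p _ _ Pp1 Pp2.
rewrite dotv /a /b /a' /b' [N]lock -natr1 -lock natrM; ring.
Qed.

Lemma no_slab (S : 'I_4 -> set 'rV[R]_3) (i j : 'I_4) x (e : R) :
  orthogonal_coloring S -> i != j -> 0 < e ->
  ~ (forall u, S i u \/ S j u -> e <= `|dot x u|).
Proof.
move=> hS ij e0 slab.
have x0 : x != 0.
  have [[_ _ /(_ i I)[u Su]] _] := hS; apply/eqP => x0.
  by have := slab u (or_introl Su); rewrite x0 dot0l normr0 leNgt e0.
have [c c0 cx] := exists_unit x0.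
apply: (no_two_color_band hS ij cx (mulr_gt0 c0 e0)) => u Su.
by rewrite dotZl normrM gtr0_norm // ler_pM2l // slab.
Qed.

(** Without a separator, a slab would keep both classes away from a great circle. Applying this to
    [B] and to its antipode gives the two halves. *)
Lemma class_cones_nonoverlap (S : 'I_4 -> set 'rV[R]_3) (i j : 'I_4) A B :
  orthogonal_coloring S -> i != j -> selfdual A -> selfdual B ->
  (forall u, S i u -> line_meets A u) -> (forall u, S j u -> line_meets B u) ->
  nonoverlap A B.
Proof.
move=> hS ij sA sB SA SB.
have Ssphere k u : S k u -> dot u u = 1.
  have [[Scover _ _] _] := hS.
  by move=> Su; have : cover [set: 'I_4] S u by [exists k]; rewrite Scover.
have slab (B' : set 'rV[R]_3) : selfdual B' ->
    (forall u, S j u -> line_meets B' u) -> meet A (antipode B').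
  move=> sB' SB'; have [[n n1 [An Bn]]|[x [e e0 xe]]] := opposite_or_slab sA sB'.
    by exists n.
  case: (no_slab hS ij e0 (x := x)) => u Su.
  have u1 : dot u u = 1 by case: Su => /Ssphere.
  have Nu1 : dot (- u) (- u) = 1 by rewrite dotNl dotNr opprK.
  case: Su => [/SA|/SB'] [Mu|Mu].
  - by apply: le_trans (ler_norm _); apply: xe => //; left.
  - by rewrite -normrN -dotNr; apply: le_trans (ler_norm _); apply: xe => //; left.
  - by apply: le_trans (ler_norm _); apply: xe => //; right.
  - by rewrite -normrN -dotNr; apply: le_trans (ler_norm _); apply: xe => //; right.
split; last exact: slab.
rewrite -[B]antipodeK; apply: slab; first exact: selfdual_antipode.
by move=> u /SB; rewrite line_meets_antipode.
Qed.

Lemma three_other_colors (i : 'I_4) : exists j k l : 'I_4,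
  [/\ i != j, i != k & i != l] /\ [/\ j != k, j != l & k != l].
Proof.
by case: i => [[|[|[|[|//]]]] ilt]; exists (Ordinal ilt + 1),
  (Ordinal ilt + 2%:R), (Ordinal ilt + 3%:R).
Qed.

Lemma class_octant (S : 'I_4 -> set 'rV[R]_3) : orthogonal_coloring S ->
  (forall i, triple_nonneg (S i)) ->
  forall i, exists u v w, frame u v w /\ forall x, S i x ->
    [/\ 0 <= dot x u, 0 <= dot x v & 0 <= dot x w] \/
    [/\ dot x u <= 0, dot x v <= 0 & dot x w <= 0].
Proof.
move=> hS S3 i.
have [M MP] := boolp.choice (fun k => class_cone (fun u v => hS.2 k u v) (S3 k)).
have sM k : selfdual (M k) by case: (MP k).
have no k l : k != l -> nonoverlap (M k) (M l).
  by move=> kl; apply: (class_cones_nonoverlap hS kl) => // u; apply: (MP _).2.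
have [j [k [l [[ij ik il] [jk jl kl]]]]] := three_other_colors i.
have [u [v [w [F Mu Mv Mw]]]] := contains_frame (sM i) (sM j) (sM k) (sM l)
  (no _ _ ij) (no _ _ ik) (no _ _ il) (no _ _ jk) (no _ _ jl) (no _ _ kl).
exists u, v, w; split=> // x /(MP i).2[Mx|Mx]; [left|right].
  by split; apply: (selfdual_dot (sM i)).
by split; rewrite -oppr_ge0 -dotNl; apply: (selfdual_dot (sM i)).
Qed.
End Coloring.

(** * Octahedral sets *)

Section Octahedron.
Context {R : realType}.
Implicit Types (e : 'I_3 -> 'rV[R]_3) (F S : set 'rV[R]_3).

Lemma convex_setP (C : set 'rV[R]_3) :
  convex_set (C : set (convex_lmodType 'rV[R]_3)) <->
  forall x y (t : R), 0 <= t -> t <= 1 -> C x -> C y -> C (t *: x + (1 - t) *: y).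
Proof.
split=> [cC x y t t0 t1 Cx Cy|cC x y l /set_mem Cx /set_mem Cy].
  by have /set_mem := cC x y (Itv01 t0 t1) (mem_set Cx) (mem_set Cy).
by apply/mem_set/cC.
Qed.

(** The unit ball of the l1 norm is convex and contains the vertices. *)
Lemma octahedron_norm1 e x : orthonormal_basis e -> octahedron e x ->
  `|dot x (e 0)| + `|dot x (e 1)| + `|dot x (e 2%:R)| <= 1.
Proof.
move=> eO Ox.
apply: (Ox [set y | `|dot y (e 0)| + `|dot y (e 1)| + `|dot y (e 2%:R)| <= 1]).
split.
  apply/convex_setP => y z t t0 t1 /= Cy Cz.
  have norm_le u : `|dot (t *: y + (1 - t) *: z) u| <=
      t * `|dot y u| + (1 - t) * `|dot z u|.
    rewrite dotDl !dotZl (le_trans (ler_normD _ _)) // !normrM.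
    by rewrite (ger0_norm t0) (@ger0_norm _ (1 - t)) ?subr_ge0.
  have := norm_le (e 0); have := norm_le (e 1); have := norm_le (e 2%:R).
  nra.
have vertex i : `|dot (e i) (e 0)| + `|dot (e i) (e 1)| + `|dot (e i) (e 2%:R)| <= 1.
  by rewrite !eO; case: i => [[|[|[|//]]] ?]; rewrite /= ?normr0 ?normr1 ?add0r ?addr0.
by move=> y /= [[i _ <-]|[i _ <-]] //; rewrite !dotNl !normrN.
Qed.

Lemma octahedron_vertex e i : octahedron e (e i) /\ octahedron e (- e i).
Proof. by split; move=> C [_ sub]; apply: sub; [left|right]; exists i. Qed.

Lemma octahedron_face e (a b c : R) : 0 <= a -> 0 <= b -> 0 <= c ->
  a + b + c = 1 -> octahedron e (a *: e 0 + b *: e 1 + c *: e 2%:R).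
Proof.
move=> a0 b0 c0 abc C [/convex_setP cC sub].
have Ce i : C (e i) by apply: sub; left; exists i.
have [c1|c1] := eqVneq c 1.
  have [-> ->] : a = 0 /\ b = 0 by split; lra.
  by rewrite c1 !scale0r !add0r scale1r.
have d0 : 0 < 1 - c by rewrite subr_gt0 lt_neqAle c1 /=; lra.
have c_le1 : c <= 1 by lra.
have a1 : 0 <= a / (1 - c) by rewrite divr_ge0 // ltW.
have a2 : a / (1 - c) <= 1 by rewrite ler_pdivrMr // mul1r; lra.
have := cC _ _ c c0 c_le1 (Ce 2%:R) (cC _ _ _ a1 a2 (Ce 0) (Ce 1)).
rewrite scalerDr !scalerA mulrBr mulr1 mulrCA divff ?gt_eqF // mulr1.
by rewrite (_ : 1 - c - a = b) 1?addrC //; lra.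
Qed.

Lemma orthonormal_frame e : orthonormal_basis e -> frame (e 0) (e 1) (e 2%:R).
Proof. by move=> eO; split; rewrite ?eO. Qed.

Lemma frame_orthonormal u v w : frame u v w ->
  exists2 e : 'I_3 -> 'rV[R]_3, orthonormal_basis e & [/\ e 0 = u, e 1 = v & e 2%:R = w].
Proof.
move=> [u1 v1 w1 uv [uw vw]]; exists (fun i => nth 0 [:: u; v; w] i) => //.
by move=> [[|[|[|//]]] ?] [[|[|[|//]]] ?] //=; rewrite // dotC.
Qed.

(** The face is where [u + v + w] takes its maximum 1 on the octahedron. Dividing a point by its
    product with [u + v + w] moves it into that face, from the opposite octant by a negative
    factor. *)
Lemma octants_octahedral S u v w : frame u v w ->
  (forall x, S x -> x != 0 /\
    ([/\ 0 <= dot x u, 0 <= dot x v & 0 <= dot x w] \/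
     [/\ dot x u <= 0, dot x v <= 0 & dot x w <= 0])) ->
  octahedral S.
Proof.
move=> uvw Suvw; have [e eO [eu ev ew]] := frame_orthonormal uvw.
have [u1 v1 w1 uv [uw vw]] := uvw.
pose c := u + v + w; pose O := octahedron e.
pose F := [set x | O x /\ forall y, O y -> dot c y <= dot c x].
have cE x : dot c x = dot x u + dot x v + dot x w by rewrite /c !dotDl !(dotC x).
have FP x : O x -> dot c x = 1 -> F x.
  move=> Ox cx; split=> // y /(octahedron_norm1 eO).
  rewrite eu ev ew cx cE; apply: le_trans.
  by rewrite !lerD // ler_norm.
have [Fu Fv Fw] : [/\ F u, F v & F w].
  rewrite -{1}eu -{1}ev -{1}ew; split; apply: FP;
    by [exact: (octahedron_vertex _ _).1
      |rewrite cE ?eu ?ev ?ew ?u1 ?v1 ?w1 ?(dotC v u) ?(dotC w u) ?(dotC w v)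
         ?uv ?uw ?vw; ring].
exists O, F; split; first by exists e.
  split.
    exists c => //; rewrite -dot_eq0 cE !dotDl (dotC v u) (dotC w u) (dotC w v).
    by rewrite u1 v1 w1 uv uw vw !(addr0, add0r) gt_eqF // !addr_gt0.
  exists u, v, w; split=> //.
  (* The products of the edges [v - u], [w - u] with [v], [w] form the identity matrix. *)
  apply/row_freeP; exists (row_mx v^T w^T).
  have dot_mx y z : y *m z^T = (dot y z)%:M.
    rewrite [LHS]mx11_scalar; congr _%:M; rewrite mxE.
    by apply: eq_bigr => i _; rewrite mxE.
  rewrite mul_col_row !dot_mx !dotDl !dotNl v1 w1 uv uw vw (dotC w v) vw.
  by rewrite !oppr0 !addr0 raddf0 -scalar_mx_block.
move=> _ [x Sx <-]; have [x0 xuvw] := Suvw x Sx.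
pose s := dot c x; have sE : s = dot x u + dot x v + dot x w := cE x.
have s0 : s != 0.
  apply: contra_neq x0; rewrite sE => s0.
  by apply: (frame_perp0 uvw); case: xuvw => -[]; move: s0; clear; lra.
have Fx : F (s^-1 *: x).
  apply: FP; last by rewrite dotZr mulVf.
  rewrite (frame_basis x uvw) !scalerDr !scalerA -eu -ev -ew eu ev ew.
  have coord_ge0 y : (0 <= s /\ 0 <= dot x y) \/ (s <= 0 /\ dot x y <= 0) ->
      0 <= s^-1 * dot x y.
    move=> [[? ?]|[? ?]]; first by rewrite mulr_ge0 ?invr_ge0.
    by rewrite mulr_le0 ?invr_le0.
  have := @octahedron_face e (s^-1 * dot x u) (s^-1 * dot x v) (s^-1 * dot x w).
  rewrite eu ev ew; apply; try (apply: coord_ge0; rewrite sE;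
    case: xuvw => -[? ? ?]; [left|right]; split=> //; lra).
  by rewrite -!mulrDr -sE mulVf.
split.
  by exists (s^-1 *: x); split=> //; exists s^-1.
exists (- (s^-1 *: x)); split; last by exists (s^-1 *: x).
by exists (- s^-1) => //; rewrite scaleNr.
Qed.

(** Equality case of Hölder's inequality: evaluating at vertices, the maximum bounds every
    coordinate of [c], while the l1 norm of [x] is at most 1. *)
Lemma face_coord e F c x : orthonormal_basis e -> c != 0 ->
  F = [set x | octahedron e x /\ forall y, octahedron e y -> dot c y <= dot c x] ->
  F x -> 0 < dot c x /\ forall i, dot c (e i) * dot x (e i) = dot c x * `|dot x (e i)|.
Proof.
move=> eO c0 -> [Ox xmax]; have eF := orthonormal_frame eO.
set m := dot c x.
have c_le i : `|dot c (e i)| <= m.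
  have [Oe Oe'] := octahedron_vertex e i.
  by rewrite ler_norml lerNl -dotNr !xmax.
have m0 : 0 < m.
  rewrite lt_neqAle (le_trans (normr_ge0 _) (c_le 0)) andbT.
  apply: contra_neq c0 => m0; apply: (frame_perp0 eF);
    by apply/eqP; rewrite -normr_le0 m0 c_le.
have termwise i : dot c (e i) * dot x (e i) <= m * `|dot x (e i)|.
  rewrite (le_trans (ler_norm _)) // normrM ler_wpM2r //; exact: c_le.
have := octahedron_norm1 eO Ox; rewrite -(ler_pM2l m0) mulr1 !mulrDr => bound.
have mE := frame_dot c x eF; rewrite -/m in mE.
have [t0 t1 t2] := And3 (termwise 0) (termwise 1) (termwise 2%:R).
split=> // -[[|[|[|//]]] i3].
- by rewrite (_ : Ordinal i3 = 0); [lra|exact/val_inj].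
- by rewrite (_ : Ordinal i3 = 1); [lra|exact/val_inj].
- by rewrite (_ : Ordinal i3 = 2%:R); [lra|exact/val_inj].
Qed.

(** In each coordinate both points have the sign of [c], and vanish where [c] does. *)
Lemma face_acute e F x y : orthonormal_basis e -> closed_face (octahedron e) F ->
  F x -> F y -> 0 <= dot x y.
Proof.
move=> eO [[c c0 FE] _] Fx Fy.
have [mx hx] := face_coord eO c0 FE Fx; have [my hy] := face_coord eO c0 FE Fy.
have term i : 0 <= dot x (e i) * dot y (e i).
  have [ci0|ci0] := eqVneq (dot c (e i)) 0.
    have := hx i; rewrite ci0 mul0r => /esym/eqP.
    by rewrite mulf_eq0 normr_eq0 gt_eqF //= => /eqP ->; rewrite mul0r.
  have -> : dot x (e i) * dot y (e i) = (dot c (e i) ^+ 2)^-1 *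
      ((dot c (e i) * dot x (e i)) * (dot c (e i) * dot y (e i))) by field.
  rewrite mulr_ge0 ?invr_ge0 ?sqr_ge0 //.
  by rewrite hx hy !mulr_ge0 // ltW.
by rewrite (frame_dot x y (orthonormal_frame eO)) !addr_ge0.
Qed.

Lemma face_neq0 e F : orthonormal_basis e -> closed_face (octahedron e) F ->
  ~ F 0.
Proof.
move=> eO [[c c0 FE] _] F0; have [] := face_coord eO c0 FE F0.
by rewrite dotC dot0l ltxx.
Qed.

(** Rescaling the three vectors into the face multiplies the triple product by a positive square. *)
Lemma octahedral_triple_nonneg S : octahedral S -> triple_nonneg S.
Proof.
move=> [_ [F [[e eO ->] eF SF]]] u v w Su Sv Sw.
have meet_face x : S x -> exists2 t : R, t != 0 & F (t *: x).
  move=> Sx; have [|[_ [[t _ <-] Ft]] _] := SF (line_through x).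
    by exists x.
  exists t => //; apply/eqP => t0; apply: (face_neq0 eO eF).
  by rewrite -(scale0r x) -t0.
have [[r r0 Fu] [s s0 Fv] [t t0 Fw]] := And3 (meet_face u Su) (meet_face v Sv)
  (meet_face w Sw).
have rst : 0 < (r * s * t) ^+ 2 by rewrite exprn_even_gt0 //= !mulf_neq0.
rewrite -(pmulr_rge0 _ rst) (_ : _ ^+ 2 * _ = dot (r *: u) (s *: v) *
  dot (r *: u) (t *: w) * dot (s *: v) (t *: w)).
  by rewrite !mulr_ge0 ?(face_acute eO eF).
by rewrite !dotZl !dotZr; ring.
Qed.

Lemma octahedral_subset S S' : S' `<=` S -> octahedral S -> octahedral S'.
Proof.
move=> sub [O [F [RO OF SF]]]; exists O, F; split=> // _ [u Su <-].
by apply: SF; exists u => //; exact: sub.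
Qed.

Lemma exists_frame : exists u v w : 'rV[R]_3, frame u v w.
Proof.
have [u u1 _] := @exists_orthogonal R 0; have [v v1 vu] := exists_orthogonal u.
by exists v, u, (cross v u); exact: cross_frame.
Qed.

(** * Three points in an octant *)

Lemma dot_sign_ge0 (x y : 'rV[R]_3) :
  exists2 s : R, s * s = 1 & 0 <= dot x (s *: y).
Proof.
have [xy|/ltW xy] := lerP 0 (dot x y); first by exists 1; rewrite ?mulr1 ?scale1r.
by exists (-1); rewrite ?mulrNN ?mulr1 // scaleN1r dotNr oppr_ge0.
Qed.

(** The hypothesis says that the projections of [y] and [z] orthogonal to [a] do not form an obtuse
    angle. Take [f] along the projection of [y], and the sign of [g] from [z]. *)
Lemma octant_at_vertex (a y z : 'rV[R]_3) : dot a a = 1 -> 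
  dot y a * dot z a <= dot y z -> exists f g, frame a f g /\
    [/\ 0 <= dot y f, 0 <= dot y g, 0 <= dot z f & 0 <= dot z g].
Proof.
move=> a1 yz.
suff [f [f1 fa yf [zf yE]]] : exists f, [/\ dot f f = 1, dot f a = 0,
    0 <= dot y f & 0 <= dot z f /\ y = dot y a *: a + dot y f *: f].
  have F := cross_frame a1 f1 (etrans (dotC a f) fa).
  have [_ _ g1 af [ag fg]] := F.
  have [s s1 zg] := dot_sign_ge0 z (cross a f).
  exists f, (s *: cross a f); split.
    by split; rewrite ?dotZr ?dotZl ?g1 ?mulr1 ?af ?ag ?fg ?mulr0.
  split=> //; rewrite {1}yE dotDl !dotZl !dotZr ag fg !mulr0 addr0 //.
pose y' := y - dot y a *: a.
have y'a : dot y' a = 0 by rewrite dotDl dotNl dotZl a1; ring.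
have [y0|y0] := eqVneq y' 0.
  have yE : y = dot y a *: a by apply/eqP; rewrite -subr_eq0 -/y' y0.
  have [f f1 fa] := exists_orthogonal a; have [s s1 zf] := dot_sign_ge0 z f.
  have ysf : dot y (s *: f) = 0 by rewrite yE dotZl dotZr (dotC a) fa !mulr0.
  exists (s *: f); split; rewrite ?ysf ?scale0r ?addr0 //.
    by rewrite dotZl dotZr f1 mulr1.
  by rewrite dotZl fa mulr0.
have [k k0 f1] := exists_unit y0; exists (k *: y').
have y'y : dot y y' = dot y' y'.
  by rewrite {3}/y' dotDl dotNl dotZl (dotC a) y'a mulr0 subr0.
have zy' : dot z y' = dot y z - dot y a * dot z a.
  by rewrite /y' dotDr dotNr dotZr (dotC z y).
split; first exact: f1.
- by rewrite dotZl y'a mulr0.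
- by rewrite dotZr y'y mulr_ge0 ?dot_ge0 // ltW.
rewrite !dotZr y'y.
split; first by rewrite zy' mulr_ge0 ?subr_ge0 // ltW.
have kk : k * dot y' y' * k = 1 by rewrite -f1 dotZl dotZr; ring.
by rewrite scalerA kk scale1r /y' addrC subrK.
Qed.

(** The spherical triangle is not obtuse at both [a] and [b]: as [dot a b <= 1], that would make
    each of [dot a c], [dot b c] smaller than the other. *)
Lemma acute_triple_octant (a b c : 'rV[R]_3) : dot a a = 1 -> dot b b = 1 ->
  0 <= dot a b -> 0 <= dot a c -> 0 <= dot b c ->
  exists u v w, frame u v w /\ forall x, x = a \/ x = b \/ x = c ->
    [/\ 0 <= dot x u, 0 <= dot x v & 0 <= dot x w].
Proof.
move=> a1 b1 ab ac bc.
have [h|h] := lerP (dot b a * dot c a) (dot b c).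
  have [f [g [F [bf bg cf cg]]]] := octant_at_vertex a1 h.
  have [_ _ _ af [ag _]] := F.
  exists a, f, g; split=> // x [->|[->|->]]; split;
    by rewrite ?a1 ?af ?ag // dotC.
have [h'|h'] := lerP (dot a b * dot c b) (dot a c).
  have [f [g [F [af ag cf cg]]]] := octant_at_vertex b1 h'.
  have [_ _ _ bf [bg _]] := F.
  exists b, f, g; split=> // x [->|[->|->]]; split;
    by rewrite ?b1 ?bf ?bg // dotC.
exfalso; move: h h'; rewrite (dotC b a) (dotC c a) (dotC c b) => h h'.
have ab1 : dot a b <= 1.
  have := dot_ge0 (a - b); rewrite dotDl !dotDr !dotNl !dotNr opprK a1 b1 (dotC b a).
  lra.
have : dot a b * dot a c <= dot a c by rewrite ler_piMl.
have : dot a b * dot b c <= dot b c by rewrite ler_piMl.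
lra.
Qed.

Lemma card_le3P S : (S #<= `I_3)%card -> S = set0 \/
  exists u v w, [/\ S u, S v & S w] /\ S `<=` [set u; v; w].
Proof.
move=> /pfcard_geP[->|[g]]; [by left|right].
have gS k : (k < 3)%N -> S (g k) by move=> k3; apply: (@funS _ _ _ _ g).
exists (g 0%N), (g 1%N), (g 2%N); split=> [|x Sx]; first by split; exact: gS.
have [k /= k3 <-] := @surj _ _ _ _ g x Sx.
by case: k k3 => [|[|[|//]]] _ /=; [left; left|left; right|right].
Qed.

Lemma set3_card_le (u v w : 'rV[R]_3) : ([set u; v; w] #<= `I_3)%card.
Proof.
apply: card_le_trans (card_image_le (nth w [:: u; v; w]) `I_3).
apply: subset_card_le => x /= [[->|->]|->].
- by exists 0%N.
- by exists 1%N.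
- by exists 2%N.
Qed.

(** Signs for [v] and [w] make their products with [u] positive; the triple condition then makes the
    third product nonnegative. *)
Lemma triple_nonneg_locally_octahedral S :
  (forall u v, S u -> S v -> dot u v != 0) -> (forall u, S u -> dot u u = 1) ->
  triple_nonneg S -> locally_octahedral S.
Proof.
move=> S0 S1 S3 S' sub /card_le3P[->|[u [v [w [[S'u S'v S'w] S'E]]]]].
  by have [f [g [h F]]] := exists_frame; apply: (octants_octahedral F).
have [Su Sv Sw] := And3 (sub _ S'u) (sub _ S'v) (sub _ S'w).
have [s ss uv] := dot_sign_ge0 u v; have [t tt uw] := dot_sign_ge0 u w.
have sign_neq0 (z : R) : z * z = 1 -> z != 0.
  by move=> zz; apply/eqP => z0; move/eqP: zz; rewrite z0 mul0r eq_sym oner_eq0.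
have uv_gt0 : 0 < dot u (s *: v).
  by rewrite lt0r uv dotZr mulf_neq0 ?(sign_neq0 _ ss) ?(S0 _ _ Su Sv).
have uw_gt0 : 0 < dot u (t *: w).
  by rewrite lt0r uw dotZr mulf_neq0 ?(sign_neq0 _ tt) ?(S0 _ _ Su Sw).
have vw : 0 <= dot (s *: v) (t *: w).
  rewrite -(pmulr_rge0 _ (mulr_gt0 uv_gt0 uw_gt0)).
  rewrite dotZl !dotZr (_ : _ * _ * _ = (s * s) * (t * t) *
    (dot u v * dot u w * dot v w)); last by ring.
  by rewrite ss tt !mul1r S3.
have v1 : dot (s *: v) (s *: v) = 1 by rewrite dotZl dotZr mulrA ss S1 ?mul1r.
have [f [g [h [F Fpos]]]] := acute_triple_octant (S1 u Su) v1 uv uw vw.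
apply: (octants_octahedral F) => x S'x; split.
  exact/dot_unit_neq0/S1/sub.
have octant (z : R) y : z * z = 1 ->
    [/\ 0 <= dot (z *: y) f, 0 <= dot (z *: y) g & 0 <= dot (z *: y) h] ->
    [/\ 0 <= dot y f, 0 <= dot y g & 0 <= dot y h] \/
    [/\ dot y f <= 0, dot y g <= 0 & dot y h <= 0].
  move=> /eqP; rewrite -expr2 sqrf_eq1 => /orP[]/eqP ->.
    by rewrite scale1r; left.
  by rewrite scaleN1r !dotNl !oppr_ge0; right.
case: (S'E _ S'x) => [[->|->]|->].
- by left; apply: Fpos; left.
- by apply: (octant s) => //; apply: Fpos; right; left.
- by apply: (octant t) => //; apply: Fpos; right; right.
Qed.

Lemma locally_octahedral_triple_nonneg S :
  locally_octahedral S -> triple_nonneg S.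
Proof.
move=> loc u v w Su Sv Sw.
have /octahedral_triple_nonneg : octahedral [set u; v; w].
  by apply: loc; [move=> x /= [[->|->]|->]|exact: set3_card_le].
by apply; rewrite /=; auto.
Qed.
End Octahedron.

Theorem theorem2 (R : realType) (S : 'I_4 -> set 'rV[R]_3)
    (hS : orthogonal_coloring S) :
  (octahedral_coloring S <-> (forall i : 'I_4, locally_octahedral (S i))) /\
  (forall i : 'I_4, locally_octahedral (S i) <->
     (forall u v w : 'rV[R]_3, S i u -> S i v -> S i w ->
        0 <= dot u v * dot u w * dot v w)).
Proof.
have unit i u : S i u -> dot u u = 1.
  have [[Scover _ _] _] := hS.
  by move=> Su; have : cover [set: 'I_4] S u by [exists i]; rewrite Scover.
split; last first.
  move=> i; split; first exact: locally_octahedral_triple_nonneg.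
  by apply: triple_nonneg_locally_octahedral; [exact: hS.2|exact: unit].
split=> [oct i S' sub _|loc i]; first exact: octahedral_subset sub (oct i).
have [f [g [h [F Foct]]]] :=
  class_octant hS (fun j => locally_octahedral_triple_nonneg (loc j)) i.
apply: (octants_octahedral F) => x Sx; split; last exact: Foct.
exact/dot_unit_neq0/(unit i).
Qed.
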